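(* Let $G$ be a locally compact abelian group, let $1\le p,q,r<\infty$, let $\vartheta_1,\vartheta_3$ be Beurling weights on $G$ and $\vartheta_2,\vartheta_4$ Beurling weights on the dual group $\widehat G$. Then the inclusion $A^{p,1,q,r}_{\vartheta_1,\vartheta_2}(G)\subset A^{p,1,q,r}_{\vartheta_3,\vartheta_4}(G)$ holds if and only if $A^{p,1,q,r}_{\vartheta_1,\vartheta_2}(G)$ is continuously embedded in $A^{p,1,q,r}_{\vartheta_3,\vartheta_4}(G)$.
   Context: ''$X$ is continuously embedded in $Y$'' means $X\subset Y$ and there is $c>0$ with $\|f\|_Y\le c\|f\|_X$ for all $f\in X$. A Beurling weight on a locally compact abelian group $G$ is a measurable, locally integrable function $\vartheta:G\to(0,\infty)$ with $\vartheta(x)\ge 1$ and $\vartheta(x+y)\le\vartheta(x)\vartheta(y)$ for all $x,y\in G$. Amalgam spaces: by the structure theorem write $G=\mathbb R^a\times G_1$ with $a\ge 0$ an integer and $G_1$ a locally compact abelian group containing an open compact subgroup $H$. Put $I=[0,1)^a\times H$, $J=\mathbb Z^a\times T$ with $T$ a transversal of $H$ in $G_1$ (so $G_1=\bigcup_{t\in T}(t+H)$ is a coset decomposition), and $I_\alpha=\alpha+I$ for $\alpha\in J$; $G$ is the disjoint union of the $I_\alpha$, and Haar measure is normalized so that $I$ has measure $1$. For $1\le p,q<\infty$ let $\|f\|_{pq}=\big(\sum_{\alpha\in J}\|f\|_{L^p(I_\alpha)}^q\big)^{1/q}$. For a weight $\vartheta$, $(L^p_\vartheta,\ell^q)$ is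 the space of $f\in L^p_{loc}(G)$ (mod a.e. equality) with $\|f\|_{pq,\vartheta}:=\|f\vartheta\|_{pq}<\infty$. The same definitions are used on $\widehat G$. $\widehat f(\gamma)=\int_G f(x)\overline{\langle x,\gamma\rangle}\,dx$ is the Fourier transform. For Beurling weights $\vartheta$ on $G$ and $\omega$ on $\widehat G$, define $A^{p,1,q,r}_{\vartheta,\omega}(G)=\{f\in(L^p_{\vartheta},\ell^1):\widehat f\in(L^q_{\omega},\ell^r)\}$, the second space being taken on $\widehat G$, with norm $\|f\|^{p,1,q,r}_{\vartheta,\omega}=\|f\|_{p1,\vartheta}+\|\widehat f\|_{qr,\omega}$. *)

(* Defs.v *)
From HB Require Import structures.
From mathcomp Require Import all_boot all_order all_algebra complex.
From mathcomp Require Import all_classical all_reals all_analysis.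
From mathcomp Require Import ring.

Set Implicit Arguments.
Unset Strict Implicit.
Unset Printing Implicit Defensive.

Import Order.TTheory GRing.Theory Num.Theory.
Import numFieldNormedType.Exports.
Import ComplexField.Normc.

Local Open Scope classical_set_scope.
Local Open Scope ring_scope.

(* Abelian groups are written additively, the dual group included. The scalar
   field C is [R[i]] for an arbitrary [R : realType]; its topology is that of
   [R[i]^o]. *)

Section DualGroup.
Variables (R : realType) (G : topologicalZmodType).

Definition is_character (chi : G -> R[i]) : Prop :=
  [/\ continuous (chi : G -> R[i]^o),
      forall x, `|chi x| = 1 &
      {morph chi : x y / x + y >-> x * y}].

Record dual := Dual { dual_fun :> G -> R[i]; dualP : is_character dual_fun }.

Lemma dual_ext (chi psi : dual) : (forall x, chi x = psi x) -> chi = psi.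
Proof.
case: chi psi => [f fP] [g gP] /= /funext fg; rewrite fg in fP *.
by congr Dual; exact: Prop_irrelevance.
Qed.

Lemma dual_norm (chi : dual) x : `|chi x| = 1.
Proof. by case: (dualP chi). Qed.

Lemma dual_neq0 (chi : dual) x : chi x != 0.
Proof. by rewrite -normr_eq0 dual_norm oner_eq0. Qed.

Lemma dual_continuous (chi : dual) : continuous (chi : G -> R[i]^o).
Proof. by case: (dualP chi). Qed.

HB.instance Definition _ := gen_eqMixin dual.
HB.instance Definition _ := gen_choiceMixin dual.

Lemma is_character1 : is_character (fun=> 1).
Proof.
split=> [|x|x y]; [exact: cst_continuous|by rewrite normr1|by rewrite mulr1].
Qed.

Lemma is_characterM (chi psi : dual) : is_character (fun x => chi x * psi x).
Proof.
split=> [x|x|x y].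
- by apply: (@cvgM R[i]); exact: dual_continuous.
- by rewrite normrM !dual_norm mulr1.
- by have [_ _ ->] := dualP chi; have [_ _ ->] := dualP psi; rewrite mulrACA.
Qed.

Lemma is_characterV (chi : dual) : is_character (fun x => (chi x)^-1).
Proof.
split=> [x|x|x y].
- by apply: (@cvgV R[i]); [exact: dual_neq0|exact: dual_continuous].
- by rewrite normfV dual_norm invr1.
- by have [_ _ ->] := dualP chi; rewrite invfM.
Qed.

Let dual0 := Dual is_character1.
Let dualD (chi psi : dual) := Dual (is_characterM chi psi).
Let dualN (chi : dual) := Dual (is_characterV chi).

Let dualDA : associative dualD.
Proof. by move=> a b c; apply: dual_ext => x /=; rewrite mulrA. Qed.

Let dualDC : commutative dualD.
Proof. by move=> a b; apply: dual_ext => x /=; rewrite mulrC. Qed.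

Let dual0D : left_id dual0 dualD.
Proof. by move=> a; apply: dual_ext => x /=; rewrite mul1r. Qed.

Let dualND : left_inverse dual0 dualN dualD.
Proof. by move=> a; apply: dual_ext => x /=; rewrite mulVf// dual_neq0. Qed.

HB.instance Definition _ :=
  GRing.isZmodule.Build dual dualDA dualDC dual0D dualND.

HB.instance Definition _ := Topological.copy dual
  (initial_topology (fun chi : dual => (chi : G -> R[i]) : {compact-open, G -> R[i]^o})).

Lemma dual_cvgP (F : set_system dual) (chi : dual) : Filter F ->
  F --> chi <-> forall (K : set G) (e : R[i]), compact K -> 0 < e ->
    F [set psi : dual | forall x, K x -> `|chi x - psi x| < e].
Proof.
move=> FF.
pose j (psi : dual) : {compact-open, G -> R[i]^o} := (psi : G -> R[i]).
have jE : F --> chi <-> j @ F --> j chi.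
  split=> [Fc|jF].
    by apply: (cvg_trans (cvg_app j Fc)); exact: (@initial_continuous dual _ j).
  move=> A [_ [[B oB <-] Bc] BA]; apply: (filterS BA).
  by apply: jF; exact: open_nbhs_nbhs.
rewrite jE.
have -> : (j @ F --> j chi) <->
    {family compact, (j @ F : set_system (G -> R[i]^o)) --> (chi : G -> R[i]^o)}.
  by apply: compact_open_fam_compactP; exact: dual_continuous.
rewrite fam_cvgP; split=> [H K e cK e0|H K cK].
  have := H K cK [set h | forall x, K x -> `|chi x - h x| < e]; apply.
  apply/uniform_nbhs; exists [set uv : R[i]^o * R[i]^o | `|uv.1 - uv.2| < e].
  by split=> //; rewrite -entourage_ballE; exists e.
move=> P /uniform_nbhs[E [+ EP]].
rewrite -entourage_ballE => -[e /= e0 eE].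
have := H K e cK e0; apply: filterS => psi psiP.
by apply: EP => y Ky; apply: eE; exact: psiP.
Qed.

Let dual_sub_continuous : continuous (fun u : dual * dual => u.1 - u.2).
Proof.
move=> [a b]; apply/dual_cvgP => K e cK e0.
have e20 : 0 < e / 2 by rewrite divr_gt0.
have /dual_cvgP/(_ K _ cK e20) Ha : u.1 @[u --> (a, b)] --> a by exact: cvg_fst.
have /dual_cvgP/(_ K _ cK e20) Hb : u.2 @[u --> (a, b)] --> b by exact: cvg_snd.
rewrite /nbhs /= in Ha Hb |- *; move: Ha Hb; apply: filterS2 => u /= Ha Hb x Kx.
have ax := Ha x Kx; have bx := Hb x Kx.
have -> : a x / b x - u.1 x / u.2 x =
    (a x - u.1 x) / b x - u.1 x * (b x - u.2 x) / (b x * u.2 x).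
  by field; rewrite !dual_neq0.
rewrite (le_lt_trans (ler_normB _ _))// !(normrM, normfV) !dual_norm.
by rewrite !(mulr1, mul1r, invr1) [ltRHS]splitr ltrD.
Qed.

HB.instance Definition _ :=
  PreTopologicalNmodule_isTopologicalZmodule.Build dual dual_sub_continuous.

End DualGroup.

(* A copy of [G] carrying the Borel sigma-algebra. *)
Definition borel (G : topologicalZmodType) : Type := G.
HB.instance Definition _ (G : topologicalZmodType) := Choice.on (borel G).
HB.instance Definition _ (G : topologicalZmodType) :=
  isPointed.Build (borel G) (0 : G).
HB.instance Definition _ (G : topologicalZmodType) :=
  Measurable.copy (borel G)
    (g_sigma_algebraType (@open G : set (set (borel G)))).

(* The Haar measure is taken inner regular on all Borel sets. It agrees on
   sigma-finite sets with the version that is outer regular; on a group that is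
   not sigma-compact, it is the version for which locally null Borel sets are
   null, so that the L^p and amalgam seminorms vanish exactly on the functions
   that are zero almost everywhere. *)
Record is_haar (R : realType) (G : topologicalZmodType)
    (mu : {measure set (borel G) -> \bar R}) : Prop := IsHaar {
  haar_translation : forall (a : G) (A : set (borel G)), measurable A ->
    mu [set a + x | x in (A : set G)] = mu A;
  haar_compact : forall K : set G, compact K -> (mu K < +oo)%E;
  haar_regular : forall A : set (borel G), measurable A ->
    mu A = ereal_sup [set mu K | K in [set K : set G | compact K /\ K `<=` A]];
  haar_neq0 : mu [set: borel G] <> 0%E
}.

(* The data of the structure theorem: an isomorphism of topological groups from
   R^a * G_1 to G, a compact open subgroup H of G_1 and a transversal T of H.
   That G_1 is Hausdorff and locally compact follows from the same for G. *)
Record lca_decomposition (R : realType) (G : topologicalZmodType) :=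
  LCADecomposition {
    dec_dim : nat;
    dec_G1 : topologicalZmodType;
    dec_iso : 'rV[R]_dec_dim * dec_G1 -> G;
    dec_H : set dec_G1;
    dec_T : set dec_G1;
    dec_isoD : {morph dec_iso : u v / u + v >-> u + v};
    dec_iso_continuous : continuous dec_iso;
    dec_iso_homeo : exists2 g : G -> 'rV[R]_dec_dim * dec_G1,
      continuous g & cancel dec_iso g /\ cancel g dec_iso;
    dec_H0 : dec_H 0;
    dec_HB : forall x y, dec_H x -> dec_H y -> dec_H (x - y);
    dec_H_open : open dec_H;
    dec_H_compact : compact dec_H;
    dec_T_transversal : forall x, exists! t, dec_T t /\ dec_H (x - t)
  }.

Section Amalgam.
Variables (R : realType) (G : topologicalZmodType).
Variables (mu : {measure set (borel G) -> \bar R}) (D : lca_decomposition R G).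

Definition unit_cell : set G :=
  [set dec_iso u | u in [set u : 'rV[R]_(dec_dim D) * dec_G1 D |
     (forall i, 0 <= u.1 ord0 i < 1) /\ dec_H u.2]].

Definition lattice : set G :=
  [set dec_iso u | u in [set u : 'rV[R]_(dec_dim D) * dec_G1 D |
     (forall i, u.1 ord0 i \is a Num.int) /\ dec_T u.2]].

Definition cell (alpha : G) : set G := [set alpha + x | x in unit_cell].

Definition borel_measurable (f : G -> R[i]) : Prop :=
  measurable_fun [set: borel G] (fun x : borel G => complex.Re (f x)) /\
  measurable_fun [set: borel G] (fun x : borel G => complex.Im (f x)).

Definition Lp_loc (p : R) (f : G -> R[i]) : Prop :=
  borel_measurable f /\
  forall K : set G, compact K ->
    (\int[mu]_(x in (K : set (borel G))) ((normc (f x)) `^ p)%:E < +oo)%E.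

Definition Lp_norm (p : R) (A : set G) (f : G -> R[i]) : \bar R :=
  'N[mu]_p%:E[(fun x : borel G => (normc (f x))%:E) \_ A]%E.

Definition amalgam_norm (p q : R) (f : G -> R[i]) : \bar R :=
  ((\esum_(alpha in lattice) (Lp_norm p (cell alpha) f `^ q)) `^ q^-1)%E.

Definition weighted_norm (theta : G -> R) (p q : R) (f : G -> R[i]) : \bar R :=
  amalgam_norm p q (fun x => f x * (theta x)%:C%C).

(* Function spaces are sets of representatives, invariant under modification
   of a Borel function on a null set, and the norms below are constant on
   almost everywhere classes. *)
Definition amalgam_space (theta : G -> R) (p q : R) : set (G -> R[i]) :=
  [set f | Lp_loc p f /\ (weighted_norm theta p q f < +oo)%E].

Record beurling_weight (theta : G -> R) : Prop := BeurlingWeight {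
  beurling_measurable :
    measurable_fun [set: borel G] (theta : borel G -> R);
  beurling_locally_integrable : forall K : set G, compact K ->
    (\int[mu]_(x in (K : set (borel G))) (theta x)%:E < +oo)%E;
  beurling_ge1 : forall x, 1 <= theta x;
  beurling_submul : forall x y, theta (x + y) <= theta x * theta y
}.

(* The C-valued integral is computed on real and imaginary parts. *)
Definition fourier (f : G -> R[i]) (gamma : dual R G) : R[i] :=
  (Rintegral mu [set: borel G]
     (fun x => complex.Re (f x * ((gamma : G -> R[i]) x)^*%C))
   +i* Rintegral mu [set: borel G]
     (fun x => complex.Im (f x * ((gamma : G -> R[i]) x)^*%C)))%C.

End Amalgam.

Section FourierAmalgam.
Variables (R : realType) (G : topologicalZmodType).
Variables (mu : {measure set (borel G) -> \bar R}) (D : lca_decomposition R G).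
Variables (nu : {measure set (borel (dual R G)) -> \bar R})
  (Dhat : lca_decomposition R (dual R G)).
Variables (p s q r : R) (theta : G -> R) (omega : dual R G -> R).

Definition A_space : set (G -> R[i]) :=
  [set f | amalgam_space mu D theta p s f /\
           amalgam_space nu Dhat omega q r (fourier mu f)].

Definition A_norm (f : G -> R[i]) : \bar R :=
  (weighted_norm mu D theta p s f +
   weighted_norm nu Dhat omega q r (fourier mu f))%E.

End FourierAmalgam.

Definition continuously_embedded (R : realType) (V : Type)
    (X : set V) (normX : V -> \bar R) (Y : set V) (normY : V -> \bar R) : Prop :=
  X `<=` Y /\
  exists2 c : R, 0 < c & forall f, X f -> (normY f <= c%:E * normX f)%E.

(* Main.v *)
Require Import Defs.
From HB Require Import structures.
From mathcomp Require Import all_boot all_order all_algebra complex finmap.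
From mathcomp Require Import all_classical all_reals all_analysis.
From mathcomp Require Import measurable_realfun ring lra.
Set Implicit Arguments.
Unset Strict Implicit.
Unset Printing Implicit Defensive.
Import Order.TTheory GRing.Theory Num.Theory.
Import numFieldNormedType.Exports.
Import ComplexField.Normc.
Local Open Scope classical_set_scope.
Local Open Scope ring_scope.

(** An inclusion of one of these spaces into another is automatically bounded,
by the uniform boundedness principle.

Write [X] for the smaller space and [N] for its norm.  Replacing the target
weights by [min(theta3, k)] and [min(theta4, k)] gives a seminorm [P_k] with
[P_k <= k N] on [X], because [theta1] and [theta2] are at least [1].  By monotone
convergence the target norm is controlled by the supremum of the [P_k], so the
inclusion says that the family [P_k] is bounded at each point of [X].  Provided
that [X] is complete, a gliding hump argument ([uniform_boundedness]) bounds all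
the [P_k] by one constant on a ball of [N]; letting [k] go to infinity
([truncated_weight_norm_fatou]) bounds the target norm on that ball, and
homogeneity turns this bound into the continuity constant.

Completeness ([A_complete]) is obtained for absolutely convergent series
[sum_m g_m].  The sum [s] is taken pointwise where [sum_m |g_m|] is finite and is
set to [0] elsewhere; then [|s - sum_(i < n) g_i| <= sum_(m >= n) |g_m|] holds at
every point, in [[0, +oo]], since the right side is infinite wherever the series
fails to converge absolutely.  The amalgam norm is countably subadditive
([amalgam_series_le], from the Minkowski inequalities in [L^p] and [l^q] and from
monotone convergence), so this pointwise estimate passes to norms.

For the Fourier side, the amalgam norm with exponent [1] on the lattice dominates
the [L^1] norm ([integral_le_amalgam]): by the Hoelder inequality on each cell,
which has measure [1], and by adding up the cells.  A function of finite amalgam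
norm lives on countably many cells up to a set that meets every cell in a null
set, and such a set is null because the Haar measure is inner regular and a
compact set meets finitely many cells.  Therefore the transforms of the partial
sums converge at every character to the transform of [s], and the same pointwise
tail estimate holds for the transforms. *)

(** * Weighted powers and the norm of [l^q] over an arbitrary index set *)

Section EllNorm.
Context {R : realType}.
Local Open Scope ereal_scope.

(** The powers with exponents [r] and [1/r] are inverse order isomorphisms of
[[0, +oo]]; suprema and limits go through them by this equivalence. *)
Lemma poweR_leP (x y : \bar R) (r : R) : (0 < r)%R -> 0 <= x -> 0 <= y ->
  (x `^ r <= y) = (x <= y `^ r^-1).
Proof.
move=> r0 x0 y0.
have rn0 : r != 0%R by rewrite gt_eqF.
have e0 (z : \bar R) : 0 <= z -> z \in `[0, +oo] by rewrite in_itv/= leey andbT.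
apply/idP/idP => h.
- rewrite -[leLHS]poweRe1// -(divff rn0) poweRrM.
  by apply: gt0_ler_poweR; rewrite ?e0 ?poweR_ge0// invr_ge0 ltW.
- rewrite -[leRHS]poweRe1// -(mulVf rn0) poweRrM.
  by apply: gt0_ler_poweR; rewrite ?e0 ?poweR_ge0// ltW.
Qed.

Lemma le_poweR (x y : \bar R) (r : R) : (0 <= r)%R -> 0 <= x -> x <= y ->
  x `^ r <= y `^ r.
Proof.
move=> r0 x0 xy; apply: gt0_ler_poweR => //; rewrite in_itv/= leey andbT//.
exact: le_trans xy.
Qed.

(** An order isomorphism commutes with suprema, and the limit of a monotone
sequence is its supremum. *)
Lemma cvg_poweR_nondecreasing (a : nat -> \bar R) (l : \bar R) (r : R) :
  (0 < r)%R -> (forall n, 0 <= a n) -> nondecreasing_seq a ->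
  a @ \oo --> l -> a n `^ r @[n --> \oo] --> l `^ r.
Proof.
move=> r0 a0 nda al.
have lE : l = ereal_sup (range a).
  by apply: cvg_unique al (ereal_nondecreasing_cvgn nda).
have ndr : nondecreasing_seq (fun n => a n `^ r).
  by move=> m n mn; apply: le_poweR; [exact: ltW|exact: a0|exact: nda].
suff -> : l `^ r = ereal_sup (range (fun n => a n `^ r)).
  exact: ereal_nondecreasing_cvgn.
have al_le n : a n <= l by rewrite lE; apply: ereal_sup_ubound; exists n.
apply/eqP; rewrite eq_le; apply/andP; split; last first.
  apply: ge_ereal_sup => _ [n _ <-].
  by apply: le_poweR; [exact: ltW|exact: a0|exact: al_le].
have l0 : 0 <= l by apply: le_trans (a0 0%N) (al_le _).
have s0 : 0 <= ereal_sup (range (fun n => a n `^ r)).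
  apply: le_trans (poweR_ge0 (a 0%N) r) _.
  by apply: ereal_sup_ubound; exists 0%N.
rewrite poweR_leP// {1}lE; apply: ge_ereal_sup => _ [n _ <-].
by rewrite -poweR_leP//; apply: ereal_sup_ubound; exists n.
Qed.

(** Convexity of [x ^ r] at the weights [A / (A + B)] and [B / (A + B)], cleared of
denominators.  The two coefficients do not depend on [x] and [y], so the
inequality can be summed termwise. *)
Lemma powR_split (r A B : R) : (1 <= r)%R -> (0 < A)%R -> (0 < B)%R ->
  exists k : R * R, [/\ (0 <= k.1)%R, (0 <= k.2)%R,
    (k.1 * A `^ r + k.2 * B `^ r = (A + B) `^ r)%R &
    forall x y : R, (0 <= x)%R -> (0 <= y)%R ->
      ((x + y) `^ r <= k.1 * x `^ r + k.2 * y `^ r)%R].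
Proof.
move=> r1 A0 B0; set S := (A + B)%R.
have S0 : (0 < S)%R by rewrite addr_gt0.
have t01 : (0 <= A / S <= 1)%R.
  apply/andP; split; first by rewrite divr_ge0// ltW.
  by rewrite ler_pdivrMr// mul1r lerDl ltW.
have [t0 t1] := andP t01.
have tB : (1 - A / S = B / S)%R by rewrite /S; field; exact: lt0r_neq0.
exists ((S / A) `^ r * (A / S), (S / B) `^ r * (B / S))%R; split => /=.
- by rewrite mulr_ge0// powR_ge0.
- by rewrite mulr_ge0 ?powR_ge0// divr_ge0 ?ltW.
- rewrite mulrAC -powRM ?divr_ge0 ?ltW// divfK ?lt0r_neq0//.
  rewrite [X in (_ + X)%R]mulrAC -powRM ?divr_ge0 ?ltW// divfK ?lt0r_neq0//.
  by rewrite -mulrDr -mulrDl divff ?mulr1// lt0r_neq0.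
- move=> x y x0 y0.
  have xA : (0 <= S / A * x)%R by rewrite mulr_ge0// divr_ge0 ?ltW.
  have yB : (0 <= S / B * y)%R by rewrite mulr_ge0// divr_ge0 ?ltW.
  have := @convex_powR R r r1 (Itv01 t0 t1) (S / A * x)%R (S / B * y)%R.
  rewrite !inE/= !in_itv/= !andbT => /(_ xA yB).
  rewrite convRE [X in (X `^ _ <= _)%R -> _]convRE/= [unstable.onem _]tB.
  have -> : (A / S * (S / A * x) + B / S * (S / B * y) = x + y)%R.
    by field; rewrite !lt0r_neq0.
  move=> /le_trans; apply.
  have SA0 : (0 <= S / A)%R by rewrite divr_ge0// ltW.
  have SB0 : (0 <= S / B)%R by rewrite divr_ge0// ltW.
  rewrite (powRM _ SA0 x0) (powRM _ SB0 y0).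
  by rewrite le_eqVlt; apply/orP; left; apply/eqP; ring.
Qed.

Context {T : choiceType}.
Implicit Types (I : set T) (a b : T -> \bar R).

Lemma esumZ_le I a (k : R) : (0 <= k)%R -> (forall i, 0 <= a i) ->
  \esum_(i in I) (k%:E * a i) <= k%:E * \esum_(i in I) a i.
Proof.
move=> k0 a0; apply: ge_ereal_sup => _ [X XI <-].
rewrite -ge0_mule_fsumr//; apply: lee_pmul => //; first exact: fsume_ge0.
by apply: ereal_sup_ubound; exists X.
Qed.

Definition ell_norm (r : R) I a : \bar R := (\esum_(i in I) (a i `^ r)) `^ r^-1.

Lemma ell_norm_ge0 r I a : 0 <= ell_norm r I a.
Proof. exact: poweR_ge0. Qed.

Lemma ell_norm_leP r I a M : (0 < r)%R -> 0 <= M ->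
  (ell_norm r I a <= M) = (\esum_(i in I) (a i `^ r) <= M `^ r).
Proof.
move=> r0 M0.
have e0 : 0 <= \esum_(i in I) a i `^ r by apply: esum_ge0 => i _; exact: poweR_ge0.
by rewrite /ell_norm poweR_leP ?invr_gt0// invrK.
Qed.

Lemma le_ell_norm r I a b : (0 < r)%R -> (forall i, I i -> 0 <= a i <= b i) ->
  ell_norm r I a <= ell_norm r I b.
Proof.
move=> r0 ab; apply: le_poweR; first by rewrite invr_ge0 ltW.
  by apply: esum_ge0 => i _; exact: poweR_ge0.
apply: le_esum => i Ii; have /andP[a0 abi] := ab i Ii.
by apply: le_poweR => //; exact: ltW.
Qed.

Lemma ell_norm_coord r I a i : (0 < r)%R -> I i -> 0 <= a i ->
  a i <= ell_norm r I a.
Proof.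
move=> r0 Ii ai0; rewrite -poweR_leP//; last first.
  by apply: esum_ge0 => j _; exact: poweR_ge0.
by apply: esum_ge; exists [set i]; [split=> // j ->|rewrite fsbig_set1].
Qed.

Lemma ell_normZ_le r I a (k : R) : (0 < r)%R -> (0 <= k)%R ->
  (forall i, 0 <= a i) ->
  ell_norm r I (fun i => k%:E * a i) <= k%:E * ell_norm r I a.
Proof.
move=> r0 k0 a0; rewrite ell_norm_leP//; last by rewrite mule_ge0 ?ell_norm_ge0.
rewrite poweRM ?ell_norm_ge0//.
rewrite /ell_norm -poweRrM mulVf ?lt0r_neq0// poweRe1; last first.
  by apply: esum_ge0 => j _; exact: poweR_ge0.
under eq_esum do rewrite poweRM//.
by apply: esumZ_le; [exact: powR_ge0|move=> i; exact: poweR_ge0].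
Qed.

(** The Minkowski inequality, tested against strictly positive upper bounds of the
two norms: this keeps the divisions in [powR_split] harmless when a norm
vanishes. *)
Lemma ell_norm_triangle_fin r I a b (A B : R) : (1 <= r)%R ->
  (0 < A)%R -> (0 < B)%R ->
  (forall i, I i -> 0 <= a i) -> (forall i, I i -> 0 <= b i) ->
  ell_norm r I a <= A%:E -> ell_norm r I b <= B%:E ->
  ell_norm r I (fun i => a i + b i) <= (A + B)%:E.
Proof.
move=> r1 A0 B0 a0 b0 aA bB.
have r0 : (0 < r)%R by apply: lt_le_trans r1.
have afin i : I i -> a i \is a fin_num.
  move=> Ii; rewrite ge0_fin_numE ?a0//.
  apply: le_lt_trans (ltry A); apply: le_trans aA.
  by apply: ell_norm_coord => //; exact: a0.
have bfin i : I i -> b i \is a fin_num.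
  move=> Ii; rewrite ge0_fin_numE ?b0//.
  apply: le_lt_trans (ltry B); apply: le_trans bB.
  by apply: ell_norm_coord => //; exact: b0.
have [[k l] /= [k0 l0 kl xy]] := powR_split r1 A0 B0.
have A0' := ltW A0; have B0' := ltW B0.
move: aA bB; rewrite !ell_norm_leP ?lee_fin ?addr_ge0// => aA bB.
apply: (@le_trans _ _
    (\esum_(i in I) (k%:E * (a i `^ r) + l%:E * (b i `^ r)))).
  apply: le_esum => i Ii.
  have -> : a i = (fine (a i))%:E by rewrite fineK ?afin.
  have -> : b i = (fine (b i))%:E by rewrite fineK ?bfin.
  by rewrite -!EFinD !poweR_EFin lee_fin xy// fine_ge0 ?a0 ?b0.
rewrite esumD; last 2 first.
- by move=> i _; rewrite mule_ge0 ?poweR_ge0.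
- by move=> i _; rewrite mule_ge0 ?poweR_ge0.
rewrite poweR_EFin -kl EFinD !EFinM -!poweR_EFin.
apply: leeD; (apply: le_trans; first by apply: esumZ_le => // i; exact: poweR_ge0).
- by apply: lee_pmul => //; apply: esum_ge0 => i _; exact: poweR_ge0.
- by apply: lee_pmul => //; apply: esum_ge0 => i _; exact: poweR_ge0.
Qed.

Lemma ell_norm_triangle r I a b : (1 <= r)%R ->
  (forall i, I i -> 0 <= a i) -> (forall i, I i -> 0 <= b i) ->
  ell_norm r I (fun i => a i + b i) <= ell_norm r I a + ell_norm r I b.
Proof.
move=> r1 a0 b0.
have := ell_norm_ge0 r I a; have := ell_norm_ge0 r I b.
case EA : (ell_norm r I a) => [A| |]//=; case EB : (ell_norm r I b) => [B| |]//=;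
  rewrite ?leey// !lee_fin => B0 A0.
apply/lee_addgt0Pr => e e0; rewrite -!EFinD.
have -> : (A + B + e = (A + e / 2) + (B + e / 2))%R by field.
have e2 : (0 < e / 2)%R by rewrite divr_gt0.
apply: ell_norm_triangle_fin => //.
- by rewrite ltr_wpDl.
- by rewrite ltr_wpDl.
- by rewrite EA lee_fin lerDl ltW.
- by rewrite EB lee_fin lerDl ltW.
Qed.

(** Only finite partial sums have to be passed to the limit, since a sum over an
arbitrary index set is the supremum of its finite partial sums. *)
Lemma ell_norm_fatou r I (a : nat -> T -> \bar R) (l : T -> \bar R) M : (0 < r)%R ->
  (forall n i, I i -> 0 <= a n i) ->
  (forall i, I i -> nondecreasing_seq (a ^~ i)) ->
  (forall i, I i -> a n i @[n --> \oo] --> l i) ->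
  (forall n, ell_norm r I (a n) <= M) -> ell_norm r I l <= M.
Proof.
move=> r0 a0 nda al aM.
have M0 : 0 <= M by apply: le_trans (aM 0%N); exact: ell_norm_ge0.
rewrite ell_norm_leP//; apply: ge_ereal_sup => _ [X [finX XI] <-].
have cX : (\sum_(i \in X) a n i `^ r) @[n --> \oo] --> \sum_(i \in X) l i `^ r.
  have XE (b : T -> \bar R) : \sum_(i \in X) b i
      = (\sum_(i <- fset_set X | i \in fset_set X) b i)%R.
    by rewrite fsbig_finite//= big_seq.
  rewrite XE; under eq_fun do rewrite XE.
  apply: cvg_nnesum => i; rewrite in_fset_set// inE => /XI Ii.
    by near=> n; exact: poweR_ge0.
  by apply: cvg_poweR_nondecreasing => //; [move=> n; exact: a0|exact: nda|exact: al].
rewrite -(cvg_lim _ cX)//; apply: lime_le; first by apply/cvg_ex; eexists; exact: cX.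
near=> n; apply: le_trans (_ : \esum_(i in I) (a n i `^ r) <= _).
  by apply: esum_ge; exists X.
by rewrite -ell_norm_leP.
Unshelve. all: by end_near. Qed.

End EllNorm.

(** * The uniform boundedness principle *)

Section UniformBoundedness.
Context {R : realType}.
Local Open Scope ereal_scope.

(** A gliding hump: if the [P_i] were unbounded on every ball, one could build
points [x_n] and radii [d_n] such that [x_(n+1)] lies within [d_n / 2] of [x_n],
some [P_i] exceeds [n] at [x_(n+1)], and [d_(n+1)] is so small that this [P_i]
varies by at most [1] on the ball of radius [d_(n+1)].  All later points, and
hence the limit, stay in that ball, so some [P_i] exceeds [n - 1] at the limit, for
every [n].  Completeness is stated with absolutely convergent series because limits
of function series are constructed directly from their terms. *)
Lemma uniform_boundedness (V : zmodType) (X : set V) (N : V -> \bar R)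
    (I : Type) (P : I -> V -> \bar R) (C : I -> R) :
  X 0%R ->
  (forall x y, X x -> X y -> X (x - y)%R) ->
  (forall i x y, X x -> X y -> P i (x + y)%R <= P i x + P i y) ->
  (forall i x, X x -> P i (- x)%R = P i x) ->
  (forall i, (0 <= C i)%R) ->
  (forall i x, X x -> P i x <= (C i)%:E * N x) ->
  (forall x, 0 <= N x) ->
  (forall x, X x -> exists M : R, forall i, P i x <= M%:E) ->
  (forall g : nat -> V, (forall n, X (g n)) -> \sum_(n <oo) N (g n) < +oo ->
    exists2 s, X s &
      forall n, N (s - \sum_(i < n) g i)%R <= \sum_(n <= m <oo) N (g m)) ->
  exists2 d : R, (0 < d)%R &
    exists M : R, forall x i, X x -> N x <= d%:E -> P i x <= M%:E.
Proof.
move=> X0 XB PD PN C0 PC N0 bdd complete; apply: contrapT => unbdd.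
have XN x : X x -> X (- x)%R by move=> Xx; rewrite -[(- x)%R]sub0r; exact: XB.
have XD x y : X x -> X y -> X (x + y)%R.
  by move=> Xx Xy; rewrite -[y]opprK; apply: XB => //; exact: XN.
have large (d M : R) : (0 < d)%R ->
    exists x i, [/\ X x, N x <= d%:E & M%:E < P i x].
  move=> d0; apply: contrapT => nex; apply: unbdd; exists d => //; exists M.
  move=> x i Xx Nx; rewrite leNgt; apply/negP => MP; apply: nex.
  by exists x, i.
pose St := {u : V * R * nat | X u.1.1 /\ (0 < u.1.2)%R}.
pose pt (u : St) := (sval u).1.1; pose rad (u : St) := (sval u).1.2.
pose idx (u : St) := (sval u).2.
pose step (u v : St) := [/\ idx v = (idx u).+1,
  N (pt v - pt u)%R <= (rad u / 2)%:E, (rad v <= rad u / 2)%R &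
  exists i, (idx u)%:R%:E < P i (pt v) /\ (C i * rad v <= 1)%R].
(* The hump [g] is chosen larger than the finite value of the family at the current
   point, so that adding it cannot be compensated. *)
have stepP u : {v | step u v}.
  apply: cid; case: u => -[[x d] n] /= [Xx d0].
  have [M PM] := bdd x Xx.
  have d20 : (0 < d / 2)%R by rewrite divr_gt0.
  have [g [i [Xg Ng Pg]]] := large _ (M + n%:R)%R d20.
  have Xxg : X (x + g)%R by exact: XD.
  have e0 : (0 < Num.min (d / 2) (1 + C i)^-1)%R.
    by rewrite lt_min d20 invr_gt0 ltr_pwDl.
  exists (exist _ (x + g, Num.min (d / 2) (1 + C i)^-1, n.+1)%R (conj Xxg e0)).
  rewrite /step /pt /rad /idx/=; split => //.
  - by rewrite addrAC subrr add0r.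
  - by rewrite ge_min lexx.
  - exists i; split.
      have : P i g <= P i (x + g)%R + P i x.
        by rewrite -(PN i x Xx) -{1}(addKr x g) addrC PD//; exact: XN.
      move=> /(lt_le_trans Pg); rewrite EFinD => h.
      have : M%:E + n%:R%:E < P i (x + g)%R + M%:E.
        by apply: lt_le_trans h _; rewrite leeD2l.
      by rewrite addeC lteD2rE.
    apply: (@le_trans _ _ (C i * (1 + C i)^-1)%R).
      by rewrite ler_wpM2l// ge_min lexx orbT.
    by rewrite ler_pdivrMr ?ltr_pwDl// mul1r lerDr.
pose u0 : V * R * nat := (0, 1, 0%N)%R.
have init : X u0.1.1 /\ (0 < u0.1.2)%R by split => //=; exact: ltr01.
have [f [f0 fS]] := dependent_choice stepP (exist _ u0 init).
have idxE n : idx (f n) = n.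
  by elim: n => [|n IHn]; [rewrite f0|have [-> _ _ _] := fS n; rewrite IHn].
have Xf n : X (pt (f n)) by have [] := svalP (f n).
have rad0 n : (0 < rad (f n))%R by have [] := svalP (f n).
pose g n := (pt (f n.+1) - pt (f n))%R.
have gsum n : (\sum_(i < n) g i)%R = pt (f n).
  elim: n => [|n IHn]; first by rewrite big_ord0 f0.
  by rewrite big_ord_recr/= IHn /g addrC subrK.
(* Since each radius is at most half the preceding one, the steps are dominated by
   a telescoping sum of differences of radii. *)
have Ng n : N (g n) <= (rad (f n) - rad (f n.+1))%:E.
  have [_ h1 h2 _] := fS n; apply: le_trans h1 _; rewrite lee_fin.
  by rewrite lerBrDl -lerBrDr; apply: le_trans h2 _; lra.
have tail n : \sum_(n <= m <oo) N (g m) <= (rad (f n))%:E.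
  apply: lime_le; first by apply: is_cvg_nneseries => m _ _; exact: N0.
  near=> k.
  have nk : (n <= k)%N by near: k; exact: nbhs_infty_ge.
  apply: (@le_trans _ _ (\sum_(n <= m < k) (rad (f m) - rad (f m.+1))%:E)).
    by apply: lee_sum => m _; exact: Ng.
  rewrite sumEFin lee_fin.
  under eq_bigr do rewrite -opprB.
  by rewrite sumrN telescope_sumr// opprB lerBlDr lerDl ltW.
have [s Xs sN] := complete g (fun n => XB _ _ (Xf n.+1) (Xf n))
  (le_lt_trans (tail 0%N) (ltry _)).
have [M PM] := bdd s Xs.
have nM n : (n%:R <= M + 1 :> R)%R.
  have [_ _ _ [i [nP CP]]] := fS n; move: nP; rewrite idxE => nP.
  rewrite -lee_fin; apply/ltW/(lt_le_trans nP).
  have -> : pt (f n.+1) = (s + - (s - pt (f n.+1)))%R by rewrite subKr.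
  have Xsf : X (s - pt (f n.+1))%R by exact: XB.
  apply: le_trans (PD i _ _ Xs (XN _ Xsf)) _; rewrite PN// EFinD.
  apply: leeD; first exact: PM.
  apply: le_trans (PC i _ Xsf) _.
  apply: (@le_trans _ _ ((C i)%:E * (rad (f n.+1))%:E)); last first.
    by rewrite -EFinM lee_fin.
  apply: lee_pmul => //; first by rewrite lee_fin.
  by have := le_trans (sN n.+1) (tail n.+1); rewrite gsum.
have := archi_boundP (normr_ge0 (M + 1)%R).
rewrite ltNge => /negP; apply.
exact: le_trans (nM _) (ler_norm _).
Unshelve. all: by end_near. Qed.

End UniformBoundedness.

(** * Cells of the structure theorem *)

Lemma continuous_subr (G : topologicalZmodType) (a : G) :
  continuous (fun x : G => x - a).
Proof.
move=> x; apply: (@continuous_comp _ _ _ (fun x : G => (x, a))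
  (fun u : G * G => u.1 - u.2)); last exact: sub_continuous.
by apply: cvg_pair; [exact: cvg_id|exact: cvg_cst].
Qed.

Section Cells.
Context {R : realType} {G : topologicalZmodType}.

Lemma borel_open (A : set G) : open A -> measurable (A : set (borel G)).
Proof. exact: sub_sigma_algebra. Qed.

Lemma borel_closed (A : set G) : closed A -> measurable (A : set (borel G)).
Proof.
move=> cA; rewrite -[A]setCK; apply: measurableC; apply: borel_open.
exact: closed_openC.
Qed.

Lemma borel_compact (K : set G) : hausdorff_space G -> compact K ->
  measurable (K : set (borel G)).
Proof. by move=> hG cK; apply: borel_closed; exact: compact_closed. Qed.

Lemma compact_finite_cover (K : set G) : compact K -> cover_compact K.
Proof.
pose pG : ptopologicalType := HB.pack G (isPointed.Build G 0).
move=> cK; have : @compact pG K by [].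
by rewrite (@compact_cover pG).
Qed.

Lemma continuous_borel (f : G -> R) : continuous f ->
  measurable_fun [set: borel G] (f : borel G -> R).
Proof.
move=> cf; apply: (measurability _ (RGenOpens.measurableE R)).

move=> _ [_ [a [b ->]] <-]; rewrite setTI; apply: borel_open.
apply: open_comp; last exact: interval_open.
by move=> x _; exact: cf.
Qed.

Variable D : lca_decomposition R G.

Definition dec_inv : G -> 'rV[R]_(dec_dim D) * dec_G1 D :=
  sval (cid2 (dec_iso_homeo D)).

Lemma dec_inv_continuous : continuous dec_inv.
Proof. by rewrite /dec_inv; case: cid2. Qed.

Lemma dec_isoK : cancel (@dec_iso R G D) dec_inv.
Proof. by rewrite /dec_inv; case: cid2 => ? ? []. Qed.

Lemma dec_invK : cancel dec_inv (@dec_iso R G D).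
Proof. by rewrite /dec_inv; case: cid2 => ? ? []. Qed.

Lemma dec_invD : {morph dec_inv : x y / x + y >-> x + y}.
Proof.
by move=> x y; rewrite -{1}[x]dec_invK -{1}[y]dec_invK -dec_isoD dec_isoK.
Qed.

Lemma dec_invB : {morph dec_inv : x y / x - y >-> x - y}.
Proof.
by move=> x y; apply: (addIr (dec_inv y)); rewrite -dec_invD !subrK.
Qed.

Lemma cellE (alpha x : G) : cell D alpha x <->
  (forall i, 0 <= (dec_inv (x - alpha)).1 ord0 i < 1) /\
  dec_H (dec_inv (x - alpha)).2.
Proof.
split=> [[_ [u [u1 uH] <-] <-]|[x1 xH]].
  by rewrite addrC addKr dec_isoK.
exists (x - alpha); last by rewrite addrC subrK.
by exists (dec_inv (x - alpha)); rewrite ?dec_invK.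
Qed.

Lemma latticeE (alpha : G) : lattice D alpha <->
  (forall i, (dec_inv alpha).1 ord0 i \is a Num.int) /\ dec_T (dec_inv alpha).2.
Proof.
split=> [[u [u1 uT] <-]|[x1 xH]]; first by rewrite dec_isoK.
by exists (dec_inv alpha); rewrite ?dec_invK.
Qed.

Lemma unit_cellE : unit_cell D = cell D 0.
Proof.
apply/seteqP; split=> [x ux|_ [x ux <-]]; last by rewrite add0r.
by exists x; rewrite ?add0r.
Qed.

(** In the coordinates of the decomposition a cell is cut out by finitely many
conditions, each of them open or closed. *)
Lemma measurable_cell (alpha : G) : measurable (cell D alpha : set (borel G)).
Proof.
have cB : continuous (fun x : G => dec_inv (x - alpha)).
  move=> x; apply: (@continuous_comp _ _ _ (fun x : G => x - alpha) dec_inv).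
    exact: continuous_subr.
  exact: dec_inv_continuous.
pose c i (x : G) := (dec_inv (x - alpha)).1 ord0 i.
have cc i : continuous (c i).
  move=> x; apply: (@continuous_comp _ _ _ (fun x : G => (dec_inv (x - alpha)).1)
    (fun v : 'rV[R]_(dec_dim D) => v ord0 i)); last exact: coord_continuous.
  apply: (@continuous_comp _ _ _ (fun x : G => dec_inv (x - alpha)) fst).
    exact: cB.
  exact: cvg_fst.
have -> : cell D alpha = (\bigcap_(i in [set: 'I_(dec_dim D)])
      (c i @^-1` [set` `[0, 1[%R])) `&`
    ((fun x : G => (dec_inv (x - alpha)).2) @^-1` (@dec_H _ _ D)).
  apply/seteqP; split=> x; rewrite cellE => -[h1 h2]; split=> //.
    by move=> i _; rewrite /= in_itv/= h1.
  by move=> i; have := h1 i I; rewrite /= in_itv/=.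
apply: measurableI.
  apply: fin_bigcap_measurable; first exact: finite_finset.
  move=> i _; rewrite -[X in measurable X]setTI.
  by apply: continuous_borel => //; exact: measurable_itv.
apply: borel_open; apply: open_comp; last exact: dec_H_open.
move=> x _; apply: (@continuous_comp _ _ _ (fun x : G => dec_inv (x - alpha)) snd).
  exact: cB.
exact: cvg_snd.
Qed.

Lemma dec_HD (x y : dec_G1 D) : dec_H x -> dec_H y -> dec_H (x + y).
Proof.
move=> Hx Hy; rewrite -[y]opprK; apply: dec_HB => //.
by rewrite -sub0r; apply: dec_HB => //; exact: dec_H0.
Qed.

(** A neighbourhood of [x] where all real coordinates move by less than [1] and the
other one stays in a coset of [H] meets only the cells whose integer parts differ
from those of [x] by [-1], [0] or [1] and whose representative is that of [x]. *)
Lemma locally_finite_cells (x : G) : exists2 F : set G,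
  finite_set F /\ F `<=` lattice D &
  \forall y \near x, (\bigcup_(alpha in F) cell D alpha) y.
Proof.
set v0 := (dec_inv x).1; set h0 := (dec_inv x).2.
have [t0 [[Tt0 Ht0] _]] := dec_T_transversal h0.
(* The value [k i] in [{0, 1, 2}] encodes the shift [k i - 1] of the integer part. *)
pose pnt (k : {ffun 'I_(dec_dim D) -> 'I_3}) : G := dec_iso
  (\row_i (Num.floor (v0 ord0 i) + (k i)%:Z - 1)%:~R : 'rV[R]_(dec_dim D), t0).
exists (pnt @` setT).
  split; first by apply: finite_image; exact: finite_finset.
  move=> _ [k _ <-]; apply/latticeE; rewrite dec_isoK/=; split => // i.
  by rewrite mxE intr_int.
have near1 : \forall y \near x, forall i, `|(dec_inv y).1 ord0 i - v0 ord0 i| < 1.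
  apply: filter_forall => i.
  have : (dec_inv y).1 ord0 i @[y --> x] --> v0 ord0 i.
    apply: (@continuous_comp _ _ _ (fun x : G => (dec_inv x).1)
      (fun v : 'rV[R]_(dec_dim D) => v ord0 i)); last exact: coord_continuous.
    apply: (@continuous_comp _ _ _ dec_inv fst); first exact: dec_inv_continuous.
    exact: cvg_fst.
  move=> /cvgrPdist_lt/(_ 1 ltr01); apply: filterS => y.
  by rewrite distrC.
have near2 : \forall y \near x, dec_H ((dec_inv y).2 - h0).
  have : (dec_inv y).2 - h0 @[y --> x] --> h0 - h0.
    apply: (@continuous_comp _ _ _ (fun y => (dec_inv y).2)
      (fun h : dec_G1 D => h - h0)); last exact: continuous_subr.
    apply: (@continuous_comp _ _ _ dec_inv snd); first exact: dec_inv_continuous.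
    exact: cvg_snd.
  apply; rewrite subrr; apply: open_nbhs_nbhs; split; first exact: dec_H_open.
  exact: dec_H0.
near=> y.
have y1 : forall i, `|(dec_inv y).1 ord0 i - v0 ord0 i| < 1 by near: y.
have y2 : dec_H ((dec_inv y).2 - h0) by near: y.
pose v i := (dec_inv y).1 ord0 i.
pose d i : int := Num.floor (v i) - Num.floor (v0 ord0 i) + 1.
have d02 i : 0 <= d i < 3.
  have := y1 i; rewrite ltr_distl -/(v i) => /andP[l1 l2].
  have /andP[a1 a2] := floor_itv (v i).
  have /andP[b1 b2] := floor_itv (v0 ord0 i).
  rewrite /d; move: a1 a2 b1 b2; rewrite !intrD => a1 a2 b1 b2.
  rewrite -(ler_int R) -(ltr_int R) !intrD intrN.
  have h (a b : int) : (a%:~R < b%:~R + 1 + 1 :> R) -> a <= b + 1.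
    by move=> H; rewrite -ltzD1 -(ltr_int R) !intrD.
  have A1 : Num.floor (v0 ord0 i) <= Num.floor (v i) + 1 by apply: h; lra.
  have A2 : Num.floor (v i) <= Num.floor (v0 ord0 i) + 1 by apply: h; lra.
  move: A1 A2; rewrite -!(ler_int R) !intrD => A1 A2.
  by apply/andP; split; lra.
exists (pnt [ffun i => inord `|d i|%N]); first by exists [ffun i => inord `|d i|%N].
apply/cellE; rewrite dec_invB dec_isoK/=; split.
  move=> i; rewrite !mxE ffunE inordK; last first.
    by have /andP[p1 p2] := d02 i; rewrite -ltz_nat gez0_abs.
  have /andP[p1 p2] := d02 i; rewrite gez0_abs// /d -/(v i).
  have /andP[a1 a2] := floor_itv (v i).
  have -> : Num.floor (v0 ord0 i) + (Num.floor (v i) - Num.floor (v0 ord0 i) + 1) - 1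
    = Num.floor (v i) by ring.
  by rewrite subr_ge0 a1/= ltrBlDl; move: a2; rewrite intrD.
rewrite -[X in dec_H X]/((dec_inv y).2 - t0).
by rewrite -(subrK h0 (dec_inv y).2) -addrA; apply: dec_HD.
Unshelve. all: by end_near. Qed.

Lemma compact_cells (K : set G) : compact K -> exists2 F : set G,
  finite_set F /\ F `<=` lattice D & K `<=` \bigcup_(alpha in F) cell D alpha.
Proof.
move=> cK; pose F x := sval (cid2 (locally_finite_cells x)).
have FP x : (finite_set (F x) /\ F x `<=` lattice D) /\
    \forall y \near x, (\bigcup_(alpha in F x) cell D alpha) y.
  by rewrite /F; case: cid2.
have [|x Kx|X _ KX] := @compact_finite_cover K cK G K
    (fun x => interior (\bigcup_(alpha in F x) cell D alpha)).
- by move=> x _; exact: open_interior.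
- by exists x => //; exact: (FP x).2.
exists (\bigcup_(x in [set` X]) F x).
  split; first by apply: bigcup_finite => // x _; exact: (FP x).1.1.
  by move=> a [x _]; exact: (FP x).1.2.
move=> y /KX[x Xx /interior_subset[a Fa ya]].
by exists a => //; exists x.
Qed.

End Cells.

(** * The [L^p] norm of nonnegative functions *)

Section NonnegLnorm.
Context d {T : measurableType d} {R : realType} (mu : {measure set T -> \bar R}).
Local Open Scope ereal_scope.
Implicit Types (u v : T -> \bar R) (p : R).

Lemma ge0_LnormE p u : (forall x, 0 <= u x) ->
  'N[mu]_p%:E[u] = (\int[mu]_x (u x `^ p)) `^ p^-1.
Proof.
move=> u0; rewrite unlock; congr (_ `^ _).
by apply: eq_integral => x _; rewrite gee0_abs.
Qed.

Lemma measurable_fun_poweR u p : measurable_fun setT u ->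
  measurable_fun setT (fun x => u x `^ p).
Proof. by move=> mum; exact: (measurableT_comp (measurable_poweR p)). Qed.

Lemma ge0_le_Lnorm p u v : (0 < p)%R ->
  measurable_fun setT u -> measurable_fun setT v ->
  (forall x, 0 <= u x <= v x) -> 'N[mu]_p%:E[u] <= 'N[mu]_p%:E[v].
Proof.
move=> p0 mum mv uv.
have u0 x : 0 <= u x by have /andP[] := uv x.
have v0 x : 0 <= v x by have /andP[] := uv x; exact: le_trans.
rewrite !ge0_LnormE//; apply: le_poweR; first by rewrite invr_ge0 ltW.
  by apply: integral_ge0 => x _; exact: poweR_ge0.
apply: ge0_le_integral => //.
- by move=> x _; exact: poweR_ge0.
- exact: measurable_fun_poweR.
- exact: measurable_fun_poweR.
- by move=> x _; apply: le_poweR; [exact: ltW|exact: u0|have /andP[] := uv x].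
Qed.

Lemma ge0_LnormZ p u (k : R) : (0 < p)%R -> (0 <= k)%R ->
  measurable_fun setT u -> (forall x, 0 <= u x) ->
  Lnorm mu p%:E (fun x => k%:E * u x) = k%:E * 'N[mu]_p%:E[u].
Proof.
move=> p0 k0 mum u0; rewrite !ge0_LnormE//; last by move=> x; rewrite mule_ge0.
under eq_integral do rewrite poweRM//.
rewrite ge0_integralZl_EFin//; last 3 first.
- by move=> x _; exact: poweR_ge0.
- exact: measurable_fun_poweR.
- exact: powR_ge0.
rewrite poweRM; last 2 first.
- by rewrite lee_fin powR_ge0.
- by apply: integral_ge0 => x _; exact: poweR_ge0.
by rewrite -poweR_EFin -poweRrM divff ?lt0r_neq0// poweRe1.
Qed.

Lemma cvg_Lnorm_nondecreasing p (u : nat -> T -> \bar R) v : (0 < p)%R ->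
  (forall n, measurable_fun setT (u n)) -> (forall n x, 0 <= u n x) ->
  (forall x, nondecreasing_seq (u ^~ x)) ->
  (forall x, u n x @[n --> \oo] --> v x) ->
  'N[mu]_p%:E[u n] @[n --> \oo] --> 'N[mu]_p%:E[v].
Proof.
move=> p0 mum u0 ndu uv.
have v0 x : 0 <= v x.
  rewrite -(cvg_lim _ (uv x))//; apply: lime_ge; last by near=> n; exact: u0.
  by apply/cvg_ex; eexists; exact: uv.
under eq_fun do rewrite ge0_LnormE//.
rewrite ge0_LnormE//.
have ndp x : nondecreasing_seq (fun n => u n x `^ p).
  by move=> m n mn; apply: le_poweR; [exact: ltW|exact: u0|exact: ndu].
have vE x : limn (fun n => u n x `^ p) = v x `^ p.
  by apply/cvg_lim => //; apply: cvg_poweR_nondecreasing => //; exact: uv.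
apply: cvg_poweR_nondecreasing.
- by rewrite invr_gt0.
- by move=> n; apply: integral_ge0 => x _; exact: poweR_ge0.
- move=> m n mn; apply: ge0_le_integral => //.
  + by move=> x _; exact: poweR_ge0.
  + exact: measurable_fun_poweR.
  + exact: measurable_fun_poweR.
  + by move=> x _; exact: ndp.
have -> : \int[mu]_x (v x `^ p) = \int[mu]_x limn (fun n => u n x `^ p).
  by apply: eq_integral => x _; rewrite vE.
apply: cvg_monotone_convergence => //.
- by move=> n; exact: measurable_fun_poweR.
- by move=> n x _; exact: poweR_ge0.
Unshelve. all: by end_near. Qed.

(** The Hoelder inequality against the indicator function of [A]. *)
Lemma integral_le_Lnorm p (A : set T) (f : T -> R) : (1 <= p)%R ->
  measurable A -> mu A <= 1 -> measurable_fun setT f -> (forall x, (0 <= f x)%R) ->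
  \int[mu]_(x in A) (f x)%:E <= 'N[mu]_p%:E[(EFin \o f) \_ A].
Proof.
move=> p1 mA muA mf f0.
have pg0 : (0 < p)%R by apply: lt_le_trans p1.
have rE : (EFin \o f) \_ A = EFin \o (f \_ A).
  by apply/funext => x; rewrite /= /patch; case: ifP.
have r0 x : (0 <= (f \_ A) x)%R by rewrite /patch; case: ifP.
have mfA : measurable_fun setT (f \_ A).
  by apply/(measurable_restrictT _ mA); exact: measurable_funTS.
rewrite integral_mkcond rE.
have [->|pn1] := eqVneq p 1%R.
  by rewrite Lnorm1; under [leRHS]eq_integral do rewrite /= ger0_norm//.
have pp1 : (1 < p)%R by rewrite lt_neqAle eq_sym pn1.
pose q := (1 - p^-1)^-1%R.
have q0 : (0 < q)%R by rewrite invr_gt0 subr_gt0 invf_lt1.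
have pq : (p^-1 + q^-1 = 1)%R by rewrite /q invrK addrC subrK.
clearbody q.
have := @hoelder _ _ _ mu (f \_ A) \1_A p q mfA (measurable_indic mA) pg0 q0 pq.
rewrite Lnorm1 => h.
have -> : \int[mu]_x ((f \_ A) x)%:E = \int[mu]_x `|(EFin \o (f \_ A \* \1_A)%R) x|.
  apply: eq_integral => x _ /=; rewrite /patch indicE.
  by case: ifP => xA; rewrite ?mulr1 ?ger0_norm// mul0r.
apply: le_trans h _.
rewrite -[leRHS]mule1; apply: lee_pmul; rewrite ?Lnorm_ge0 ?lexx//.
rewrite ge0_LnormE; last by move=> x; rewrite /= lee_fin indicE ler0n.
rewrite poweR_leP ?invr_gt0// ?invrK; last first.
  by apply: integral_ge0 => x _; exact: poweR_ge0.
rewrite poweR1r.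
under eq_integral => x _.
  have -> : (EFin \o \1_A) x `^ q = (\1_A x)%:E :> \bar R.
    rewrite /= indicE; case: (x \in A); rewrite ?powR1// powR0//.
    by rewrite lt0r_neq0.
  over.
by rewrite integral_indic// setIT.
Qed.

End NonnegLnorm.

(** * The amalgam norm as a functional on nonnegative functions *)

Section AmalgamFunctional.
Context {R : realType} {G : topologicalZmodType}.
Variables (mu : {measure set (borel G) -> \bar R}) (D : lca_decomposition R G).
Variables (p q : R) (p1 : (1 <= p)%R) (q1 : (1 <= q)%R).
Local Open Scope ereal_scope.
Implicit Types (u v : borel G -> \bar R) (f g : borel G -> R).

(** The functional takes extended values because it is applied to sums of series
that may diverge. *)
Definition amalgam u : \bar R :=
  ell_norm q (lattice D) (fun alpha => 'N[mu]_p%:E[u \_ (cell D alpha)]).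

Let p0 : (0 < p)%R. Proof. exact: lt_le_trans p1. Qed.
Let q0 : (0 < q)%R. Proof. exact: lt_le_trans q1. Qed.

Lemma measurable_restrict_cell d (T : measurableType d) (h : borel G -> T) alpha :
  measurable_fun setT h ->
  measurable_fun [set: borel G] (h \_ (cell D alpha) : borel G -> T).
Proof.
move=> mh; apply: (@measurable_restrictT _ _ (borel G) _ _ h
  (measurable_cell D alpha)).1.
exact: measurable_funTS.
Qed.

Lemma amalgam_ge0 u : 0 <= amalgam u.
Proof. exact: ell_norm_ge0. Qed.

Lemma le_amalgam u v : measurable_fun setT u -> measurable_fun setT v ->
  (forall x, 0 <= u x <= v x) -> amalgam u <= amalgam v.
Proof.
move=> mum mv uv; apply: le_ell_norm => // alpha _; rewrite Lnorm_ge0/=.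
apply: ge0_le_Lnorm => //; [exact: measurable_restrict_cell..|].
by move=> x; rewrite /patch; case: ifP => // _; rewrite lexx.
Qed.

Lemma amalgamZ_le (k : R) u : (0 <= k)%R -> measurable_fun setT u ->
  (forall x, 0 <= u x) -> amalgam (fun x => k%:E * u x) <= k%:E * amalgam u.
Proof.
move=> k0 mum u0.
apply: le_trans (ell_normZ_le _ q0 k0 (fun=> Lnorm_ge0 _ _ _)).
apply: le_ell_norm => // alpha _; rewrite Lnorm_ge0/=.
rewrite le_eqVlt -ge0_LnormZ//; last 2 first.
- exact: measurable_restrict_cell.
- by move=> x; rewrite /patch; case: ifP.
apply/orP; left; apply/eqP; congr (Lnorm _ _ _).
by apply/funext => x; rewrite /patch; case: ifP; rewrite ?mule0.
Qed.

(** Monotone convergence in each cell, followed by monotone convergence of the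
sums over the lattice. *)
Lemma amalgam_fatou (u : nat -> borel G -> \bar R) v M :
  (forall n, measurable_fun setT (u n)) -> (forall n x, 0 <= u n x) ->
  (forall x, nondecreasing_seq (u ^~ x)) ->
  (forall x, u n x @[n --> \oo] --> v x) ->
  (forall n, amalgam (u n) <= M) -> amalgam v <= M.
Proof.
move=> mum u0 ndu uv.
have ru0 n alpha x : 0 <= (u n \_ (cell D alpha)) x by rewrite /patch; case: ifP.
apply: ell_norm_fatou => //.
- by move=> n alpha _; exact: Lnorm_ge0.
- move=> alpha _ m n mn; apply: ge0_le_Lnorm => //; [exact: measurable_restrict_cell..|].
  by move=> x; rewrite ru0/= /patch; case: ifP => // _; exact: ndu.
- move=> alpha _; apply: cvg_Lnorm_nondecreasing => //.
  + by move=> n; exact: measurable_restrict_cell.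
  + by move=> x m n mn; rewrite /patch; case: ifP => // _; exact: ndu.
  + move=> x; rewrite /patch; case: ifP => _; first exact: uv.
    exact: cvg_cst.
Qed.

Lemma amalgamD_le f g : measurable_fun setT f -> measurable_fun setT g ->
  (forall x, (0 <= f x)%R) -> (forall x, (0 <= g x)%R) ->
  amalgam (EFin \o (f \+ g)%R) <= amalgam (EFin \o f) + amalgam (EFin \o g).
Proof.
move=> mf mg f0 g0.
apply: le_trans (ell_norm_triangle q1 (fun _ _ => Lnorm_ge0 _ _ _)
  (fun _ _ => Lnorm_ge0 _ _ _)).
apply: le_ell_norm => // alpha _; rewrite Lnorm_ge0/=.
have rE (h : borel G -> R) :
    (EFin \o h) \_ (cell D alpha) = EFin \o (h \_ (cell D alpha)).
  by apply/funext => x; rewrite /= /patch; case: ifP.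
rewrite !rE; apply: le_trans (minkowski_EFin _ (measurable_restrict_cell _ mf)
  (measurable_restrict_cell _ mg) p1).
rewrite le_eqVlt; apply/orP; left; apply/eqP; congr (Lnorm _ _ _).
by apply/funext => x; rewrite /= /patch; case: ifP; rewrite ?addr0.
Qed.

Lemma amalgam_cst0 : amalgam (cst 0) = 0.
Proof.
apply/eqP; rewrite eq_le amalgam_ge0 andbT.
have := @amalgamZ_le 0%R (cst 0) (lexx _) (measurable_cst _) (fun=> lexx _).
by rewrite mul0e; under [X in amalgam X]eq_fun do rewrite mul0e.
Qed.

Lemma amalgam_sum_le (f : nat -> borel G -> R) n :
  (forall n, measurable_fun setT (f n)) -> (forall n x, (0 <= f n x)%R) ->
  amalgam (fun x => (\sum_(i < n) f i x)%:E) <= \sum_(i < n) amalgam (EFin \o f i).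
Proof.
move=> mf f0; elim: n => [|n IHn].
  by under [X in amalgam X]eq_fun do rewrite big_ord0; rewrite big_ord0 amalgam_cst0.
under [X in amalgam X]eq_fun do rewrite big_ord_recr/=.
rewrite big_ord_recr/=; apply: le_trans (leeD IHn (lexx _)).
apply: (@amalgamD_le (fun x => \sum_(i < n) f i x)%R) => //.
- by apply: measurable_sum.
- by move=> x; exact: sumr_ge0.
Qed.

(** Countable subadditivity: the Minkowski inequality for partial sums, then
monotone convergence. *)
Lemma amalgam_series_le (f : nat -> borel G -> R) :
  (forall n, measurable_fun setT (f n)) -> (forall n x, (0 <= f n x)%R) ->
  amalgam (fun x => \sum_(n <oo) (f n x)%:E) <= \sum_(n <oo) amalgam (EFin \o f n).
Proof.
move=> mf f0.
apply: (@amalgam_fatou (fun n x => (\sum_(i < n) f i x)%:E)).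
- by move=> n; apply/measurable_EFinP; exact: measurable_sum.
- by move=> n x; rewrite lee_fin; exact: sumr_ge0.
- move=> x m n mn; rewrite lee_fin -!(big_mkord xpredT (fun i => f i x)).
  by rewrite (big_cat_nat (leq0n m) mn)//= lerDl sumr_ge0.
- move=> x; under eq_fun do rewrite -sumEFin -(big_mkord xpredT (fun i => (f i x)%:E)).
  by apply: is_cvg_nneseries => n _ _; rewrite lee_fin.
move=> n; apply: le_trans (amalgam_sum_le n mf f0) _.
rewrite -(big_mkord xpredT (fun i => amalgam (EFin \o f i))).
by apply: nneseries_lim_ge => k _ _; exact: amalgam_ge0.
Qed.

Lemma Lnorm_cell_le_amalgam u alpha : lattice D alpha ->
  'N[mu]_p%:E[u \_ (cell D alpha)] <= amalgam u.
Proof. by move=> La; apply: (ell_norm_coord q0 La (Lnorm_ge0 _ _ _)). Qed.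

End AmalgamFunctional.

(** * Domination of the integral by the amalgam norm *)

Section Integrability.
Context {R : realType} {G : topologicalZmodType}.
Local Open Scope ereal_scope.

(** A finite sum has finitely many terms above each [1 / (n + 1)]. *)
Lemma esum_countable_support (T : choiceType) (I : set T) (a : T -> \bar R) :
  (forall i, 0 <= a i) -> \esum_(i in I) a i < +oo ->
  countable [set i | I i /\ a i != 0].
Proof.
move=> a0 fin.
(* The support is the union over [n] of the sets where [a >= 1 / (n + 1)]. *)
have -> : [set i | I i /\ a i != 0] =
    \bigcup_(n : nat) [set i | I i /\ (n.+1%:R^-1)%:E <= a i].
  apply/seteqP; split=> [i [Ii ai]|i [n _ [Ii ai]]].
    have {}ai : 0 < a i by rewrite lt0e ai a0.
    have [r r0 ra] : exists2 r : R, (0 < r)%R & r%:E <= a i.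
      case E : (a i) ai => [r| |]//; first by rewrite lte_fin => r0; exists r.
      by move=> _; exists 1%R; rewrite ?leey.
    exists (Num.truncn r^-1) => //; split=> //; apply: le_trans ra; rewrite lee_fin.
    by rewrite invf_ple ?posrE// ltW// truncnS_gt.
  split=> //; apply/eqP => ai0; move: ai; rewrite ai0 lee_fin leNgt.
  by rewrite invr_gt0 ltr0n.
apply: bigcup_countable => // n _; apply: finite_set_countable.
apply: contrapT => inf.
have [r Er] : exists r : R, \esum_(i in I) a i = r%:E.
  exists (fine (\esum_(i in I) a i)); rewrite fineK// ge0_fin_numE//.
  by apply: esum_ge0.
have [B BA Bn] := @infinite_set_fset _ _ (Num.truncn (r * n.+1%:R)).+1 inf.
have : \sum_(i \in [set` B]) a i <= r%:E.
  rewrite -Er; apply: ereal_sup_ubound; exists [set` B] => //; split => //.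
  by move=> i /BA[].
apply/negP; rewrite -ltNge.
rewrite fsbig_finite//= set_fsetK.
apply: (@lt_le_trans _ _ (\sum_(i <- B) (n.+1%:R^-1)%:E)); last first.
  rewrite big_seq [leRHS]big_seq; apply: lee_sum => i iB.
  by have [] := BA _ iB.
rewrite sumEFin lte_fin big_const_seq count_predT iter_addr_0.
rewrite -[X in (_ < X)%R]mulr_natl ltr_pdivlMr ?ltr0n//.
by apply: lt_le_trans (truncnS_gt _) _; rewrite ler_nat.
Qed.

Variables (mu : {measure set (borel G) -> \bar R}) (D : lca_decomposition R G).
Hypotheses (hausG : hausdorff_space G) (haar_mu : is_haar mu).

(** A compact subset of [A] is covered by finitely many cells, hence null; inner
regularity concludes even when [G] is not a countable union of cells. *)
Lemma locally_null (A : set (borel G)) : measurable A ->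
  (forall alpha, lattice D alpha -> mu (A `&` cell D alpha) = 0) -> mu A = 0.
Proof.
move=> mA A0; apply/eqP; rewrite eq_le measure_ge0 andbT.
rewrite (haar_regular haar_mu mA); apply: ge_ereal_sup => _ [K [cK KA] <-].
have [F [finF FL] KF] := compact_cells D cK.
have mAc alpha : measurable (A `&` cell D alpha).
  by apply: measurableI => //; exact: measurable_cell.
have K_sub : K `<=` \bigcup_(alpha in F) (A `&` cell D alpha).
  by move=> x Kx; have [a Fa ax] := KF _ Kx; exists a => //; split=> //; exact: KA.
suff : mu.-negligible K.
  by move=> /negligibleP -> //; exact: borel_compact.
apply: (@negligibleS _ _ _ mu _ _ K_sub); rewrite -bigsetU_fset_set// big_seq.
apply: big_ind => [|B C nB nC|alpha].
- exact: negligible_set0.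
- exact: negligibleU.
- by rewrite in_fset_set// inE => /FL La; apply/negligibleP => //; exact: A0.
Qed.

(** When the right side is finite, [u] integrates to [0] over all but countably many
cells.  The part of its support outside these is locally null, hence null, and
on the rest countable subadditivity of the integral applies. *)
Lemma integral_le_esum_cells (u : borel G -> \bar R) :
  measurable_fun setT u -> (forall x, 0 <= u x) ->
  \int[mu]_x u x <= \esum_(alpha in lattice D) \int[mu]_(x in cell D alpha) u x.
Proof.
move=> mum u0; set a := fun alpha => \int[mu]_(x in cell D alpha) u x.
have a0 alpha : 0 <= a alpha by exact: integral_ge0.
have [fin|] := ltP (\esum_(alpha in lattice D) a alpha) +oo; last first.
  by rewrite leye_eq => /eqP ->; rewrite leey.
pose S := [set alpha | lattice D alpha /\ a alpha != 0].
have [phi phi_inj] : exists phi : G -> nat, {in S &, injective phi}.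
  by apply/countable_injP; exact: esum_countable_support.
(* [B] enumerates the cells that carry [u]; indices outside the image of [phi] give
   the empty set. *)
pose B n : set (borel G) := \bigcup_(alpha in S `&` (phi @^-1` [set n])) cell D alpha.
have BE alpha : S alpha -> B (phi alpha) = cell D alpha.
  move=> Sa; apply/seteqP; split=> [x [b [Sb pb] bx]|x ax]; last by exists alpha.
  by rewrite (phi_inj alpha b) ?inE.
have B0 n : ~ (phi @` S) n -> B n = set0.
  move=> nS; apply/seteqP; split=> // x [b [Sb pb] bx].
  by apply: nS; exists b.
have mB n : measurable (B n).
  have [[b Sb <-]|/B0 ->//] := pselect ((phi @` S) n).
  by rewrite BE//; exact: measurable_cell.
have mnz : measurable ([set x | u x != 0] : set (borel G)).
  by rewrite -[X in measurable X]setTI; exact: emeasurable_neq.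
(* [Z] is the part of the support of [u] outside the countably many cells that carry
   a positive integral. *)
pose Z : set (borel G) := [set x | u x != 0] `\` \bigcup_n B n.
have mZ : measurable Z by apply: measurableD => //; exact: bigcupT_measurable.
have muZ : mu Z = 0.
  apply: locally_null => // alpha La.
  have [Sa|nSa] := pselect (S alpha).
    suff -> : Z `&` cell D alpha = set0 by rewrite measure0.
    apply/seteqP; split=> // x [[_ nB] ax]; apply: nB; exists (phi alpha) => //.
    by rewrite BE.
  have aa0 : a alpha = 0.
    by apply/eqP; apply: contra_notT nSa => ?; split.
  have mc := measurable_cell D alpha.
  have : ae_eq mu (cell D alpha : set (borel G)) u (cst 0).
    apply/ae_eq_integral_abs => //; first exact: measurable_funTS.
    by rewrite -aa0; apply: eq_integral => x _; rewrite gee0_abs.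
  move=> [N [mN N0 NP]]; apply/eqP; rewrite eq_le measure_ge0 andbT -N0.
  apply: le_measure; rewrite ?inE//; first exact: measurableI.
  by move=> x [[/= ux _] ax]; apply: NP => /= /(_ ax) /eqP; apply/negP.
rewrite (@ge0_negligible_integral _ _ _ mu setT Z)//.
rewrite integral_mkcond.
apply: (@le_trans _ _ (\int[mu]_x \sum_(n <oo) (u \_ (B n)) x)).
  apply: ge0_le_integral => //.
  - by move=> x _; rewrite /patch; case: ifP.
  - apply: (@measurable_restrictT _ _ _ _ _ u (measurableD measurableT mZ)).1.
    exact: measurable_funTS.
  - apply: ge0_emeasurable_sum => [n x _ _|n _]; first by rewrite /patch; case: ifP.
    by apply: (@measurable_restrictT _ _ _ _ _ u (mB n)).1; exact: measurable_funTS.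
  - move=> x _; rewrite /patch; case: ifPn => [|_]; last first.
      by apply: nneseries_ge0 => n _ _; case: ifP.
    rewrite inE => -[_ nZx].
    have [->|ux] := eqVneq (u x) 0.
      by apply: nneseries_ge0 => n _ _; case: ifP.
    have [n _ Bx] : (\bigcup_n B n) x.
      by apply: contrapT => nB; apply: nZx; split.
    apply: le_trans (nneseries_lim_ge n.+1 _); last by move=> k _ _; case: ifP.
    rewrite big_nat_recr//= mem_set// leeDr//.
    by apply: sume_ge0 => k _; case: ifP.
rewrite integral_nneseries//; last 2 first.
- move=> n; apply: (@measurable_restrictT _ _ _ _ _ u (mB n)).1.
  exact: measurable_funTS.
- by move=> n x _; rewrite /patch; case: ifP.
rewrite nneseries_esumT; last first.
  by move=> n; apply: integral_ge0 => x _; rewrite /patch; case: ifP.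
have -> : \esum_(n in [set: nat]) \int[mu]_x (u \_ (B n)) x =
    \esum_(n in phi @` S) \int[mu]_(x in B n) u x.
  rewrite [RHS]esum_mkcond; apply: eq_esum => n _; rewrite -integral_mkcond.
  by case: ifPn => //; rewrite notin_setE => /B0 ->; rewrite integral_set0.
rewrite (@reindex_esum _ _ _ S (phi @` S) phi); last by split.
apply: (@le_trans _ _ (\esum_(alpha in S) a alpha)).
  by apply: le_esum => alpha Sa; rewrite BE.
rewrite esum_mkcond [leRHS]esum_mkcond; apply: le_esum => alpha _.
case: ifPn => [|_]; last by case: ifP => _; [exact: a0|exact: lexx].
by rewrite inE => -[La _]; rewrite mem_set.
Qed.

Lemma integral_le_amalgam (p : R) (f : borel G -> R) : (1 <= p)%R ->
  mu (unit_cell D) = 1 -> measurable_fun setT f -> (forall x, (0 <= f x)%R) ->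
  \int[mu]_x (f x)%:E <= amalgam mu D p 1 (EFin \o f).
Proof.
move=> p1 mu1 mf f0.
apply: le_trans (integral_le_esum_cells _ _) _.
- exact/measurable_EFinP.
- by move=> x; rewrite lee_fin.
rewrite /amalgam /ell_norm invr1 poweRe1; last first.
  by apply: esum_ge0 => i _; exact: poweR_ge0.
apply: le_esum => alpha La; rewrite poweRe1 ?Lnorm_ge0//.
apply: integral_le_Lnorm => //; first exact: measurable_cell.
rewrite (haar_translation haar_mu) ?mu1// unit_cellE.
exact: measurable_cell.
Qed.

End Integrability.

(** * Complex-valued functions *)

Section ComplexValued.
Context {R : realType}.

Lemma normc_ge0 (z : R[i]) : 0 <= normc z.
Proof. by case: z => a b; rewrite /= sqrtr_ge0. Qed.

Lemma normc_real (t : R) : normc (t%:C)%C = `|t|.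
Proof. by rewrite /normc/= expr0n/= addr0 sqrtr_sqr. Qed.

Lemma normc_normr (z : R[i]) : `|z| = ((normc z)%:C)%C.
Proof. by case: z. Qed.

(** Real and imaginary parts are indexed by a boolean so that each statement about
both of them is proved once. *)
Definition cpart (b : bool) (z : R[i]) : R :=
  if b then complex.Re z else complex.Im z.

Lemma cpartD b z w : cpart b (z + w) = cpart b z + cpart b w.
Proof. by case: b; rewrite /cpart raddfD. Qed.

Lemma cpartN b z : cpart b (- z) = - cpart b z.
Proof. by case: b; rewrite /cpart raddfN. Qed.

Lemma cpartB b z w : cpart b (z - w) = cpart b z - cpart b w.
Proof. by case: b; rewrite /cpart raddfB. Qed.

Lemma cpart0 b : cpart b 0 = 0.
Proof. by case: b. Qed.

Lemma cpart_sum b (I : Type) (r : seq I) (P : pred I) (F : I -> R[i]) :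
  cpart b (\sum_(i <- r | P i) F i) = \sum_(i <- r | P i) cpart b (F i).
Proof.
by apply: (big_morph (cpart b)); [move=> z w; exact: cpartD|exact: cpart0].
Qed.

Lemma cpartZ b z (t : R) : cpart b (z * (t%:C)%C) = cpart b z * t.
Proof. by case: z b => x y [] /=; rewrite mulr0 ?subr0 ?add0r. Qed.

Lemma cpart_inj z w : (forall b, cpart b z = cpart b w) -> z = w.
Proof.
by move=> h; have := h true; have := h false; case: z w {h} => ? ? [? ?] /= -> ->.
Qed.

Lemma cpart_le_normc b z : `|cpart b z| <= normc z.
Proof.
case: z b => x y [] /=; rewrite -sqrtr_sqr ler_sqrt ?addr_ge0 ?sqr_ge0//.
- by rewrite lerDl sqr_ge0.
- by rewrite lerDr sqr_ge0.
Qed.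

(** Evaluations at the points of [G] are continuous and separate characters. *)
Lemma dual_hausdorff (G : topologicalZmodType) : hausdorff_space (dual R G).
Proof.
move=> chi psi clu; apply: dual_ext => x; apply: contrapT => /eqP neq.
pose e : R[i] := `|chi x - psi x| / 2.
have e0 : 0 < e by rewrite divr_gt0// normr_gt0 subr_eq0.
have near_ (phi : dual R G) : nbhs phi [set w : dual R G | `|phi x - w x| < e].
  have /dual_cvgP/(_ [set x] e (@compact_set1 _ x) e0) : nbhs phi --> phi by [].
  by apply: filterS => w; apply.
have [w [/= wchi wpsi]] := clu _ _ (near_ chi) (near_ psi).
have : `|chi x - psi x| < `|chi x - psi x|.
  rewrite [ltRHS]splitr; apply: le_lt_trans (ltrD wchi wpsi).
  have -> : chi x - psi x = (chi x - w x) - (psi x - w x) by ring.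
  exact: ler_normB.
by rewrite ltxx.
Qed.

Context {G : topologicalZmodType}.
Implicit Types (f g : G -> R[i]) (theta : G -> R).

Lemma borel_measurableP f : borel_measurable f <->
  forall b, measurable_fun [set: borel G] (fun x : borel G => cpart b (f x)).
Proof.
split=> [[f1 f2] []|h]; [exact: f1|exact: f2|].
by split; [exact: (h true)|exact: (h false)].
Qed.

Lemma measurable_normc f : borel_measurable f ->
  measurable_fun [set: borel G] (fun x : borel G => normc (f x)).
Proof.
move=> [mre mim].
have -> : (fun x : borel G => normc (f x)) =
    (@Num.sqrt R) \o (fun x => complex.Re (f x) ^+ 2 + complex.Im (f x) ^+ 2).
  by apply/funext => x /=; case: (f x).
apply: (@measurableT_comp _ _ _ _ _ _ (@Num.sqrt R)).
  by apply: continuous_measurable_fun; exact: sqrt_continuous.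
by apply: measurable_funD; exact: measurable_funX.
Qed.

Lemma borel_measurableD f g : borel_measurable f -> borel_measurable g ->
  borel_measurable (f + g).
Proof.
move=> /borel_measurableP mf /borel_measurableP mg; apply/borel_measurableP => b.
have -> : (fun x : borel G => cpart b ((f + g) x)) =
    (fun x => cpart b (f x)) \+ (fun x => cpart b (g x)).
  by apply/funext => x; rewrite fctE cpartD.
exact: measurable_funD.
Qed.

Lemma borel_measurableN f : borel_measurable f -> borel_measurable (- f).
Proof.
move=> /borel_measurableP mf; apply/borel_measurableP => b.
have -> : (fun x : borel G => cpart b ((- f) x)) = \- (fun x => cpart b (f x)).
  by apply/funext => x; rewrite fctE cpartN.
exact: measurable_funN.
Qed.

Lemma borel_measurableZ f (t : R) : borel_measurable f ->
  borel_measurable (fun x => f x * (t%:C)%C).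
Proof.
move=> /borel_measurableP mf; apply/borel_measurableP => b.
have -> : (fun x : borel G => cpart b (f x * (t%:C)%C)) = (fun x => cpart b (f x) * t).
  by apply/funext => x; rewrite cpartZ.
by apply: measurable_funM => //; exact: measurable_cst.
Qed.

Lemma borel_measurable0 : borel_measurable (0 : G -> R[i]).
Proof. by split; exact: measurable_cst. Qed.

End ComplexValued.

(** * Weighted amalgam norms and truncated weights *)

Section WeightedNorm.
Context {R : realType} {G : topologicalZmodType}.
Variables (mu : {measure set (borel G) -> \bar R}) (D : lca_decomposition R G).
Variables (p q : R) (p1 : 1 <= p) (q1 : 1 <= q).
Implicit Types (f g : G -> R[i]) (theta : G -> R).

Let p0 : 0 < p. Proof. exact: lt_le_trans p1. Qed.

Lemma weighted_normE theta f : (forall x, 0 <= theta x) ->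
  weighted_norm mu D theta p q f =
  amalgam mu D p q (fun x => (normc (f x) * theta x)%:E).
Proof.
move=> t0; rewrite /weighted_norm /amalgam_norm /amalgam /ell_norm.
congr (poweR _ _); apply: eq_esum => alpha _; congr (poweR _ _).
rewrite /Lp_norm; congr (Lnorm _ _ _); congr (patch _ _ _).
by apply/funext => x; rewrite normcM normc_real ger0_norm.
Qed.

Lemma weighted_norm_ge0 theta f : (0 <= weighted_norm mu D theta p q f)%E.
Proof. exact: poweR_ge0. Qed.

Lemma weighted_norm0 theta : (forall x, 0 <= theta x) ->
  weighted_norm mu D theta p q 0 = 0%E.
Proof.
move=> th0; rewrite weighted_normE//.
under [X in amalgam _ _ _ _ X]eq_fun do rewrite normc0 mul0r.
exact: amalgam_cst0.
Qed.

Lemma measurable_weighted theta f : borel_measurable f ->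
  measurable_fun [set: borel G] (theta : borel G -> R) ->
  measurable_fun [set: borel G] (fun x : borel G => normc (f x) * theta x).
Proof. by move=> mf mt; apply: measurable_funM => //; exact: measurable_normc. Qed.

Lemma le_weighted_norm theta theta' f g : borel_measurable f -> borel_measurable g ->
  measurable_fun [set: borel G] (theta : borel G -> R) ->
  measurable_fun [set: borel G] (theta' : borel G -> R) ->
  (forall x, 0 <= theta x) -> (forall x, 0 <= theta' x) ->
  (forall x, normc (f x) * theta x <= normc (g x) * theta' x) ->
  (weighted_norm mu D theta p q f <= weighted_norm mu D theta' p q g)%E.
Proof.
move=> mf mg mt mt' t0 t0' h; rewrite !weighted_normE//.
apply: le_amalgam => //.
- by apply/measurable_EFinP; exact: (measurable_weighted mf mt).
- by apply/measurable_EFinP; exact: (measurable_weighted mg mt').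
by move=> x; rewrite !lee_fin h mulr_ge0// normc_ge0.
Qed.

Lemma weighted_normD theta f g : borel_measurable f -> borel_measurable g ->
  measurable_fun [set: borel G] (theta : borel G -> R) ->
  (forall x, 0 <= theta x) ->
  (weighted_norm mu D theta p q (f + g)%R <=
   weighted_norm mu D theta p q f + weighted_norm mu D theta p q g)%E.
Proof.
move=> mf mg mt t0; rewrite !weighted_normE//.
apply: le_trans (amalgamD_le _ _ _ _ _ _ _ _) => //; last 4 first.
- exact: measurable_weighted.
- exact: measurable_weighted.
- by move=> x; rewrite mulr_ge0// normc_ge0.
- by move=> x; rewrite mulr_ge0// normc_ge0.
apply: le_amalgam => //.
- apply/measurable_EFinP.
  exact: (measurable_weighted (borel_measurableD mf mg) mt).
- by apply/measurable_EFinP; apply: measurable_funD; exact: measurable_weighted.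
- move=> x; rewrite /= !lee_fin mulr_ge0 ?normc_ge0//= -mulrDl ler_wpM2r//.
  exact: le_normcD.
Qed.

Lemma weighted_normN theta f :
  weighted_norm mu D theta p q (- f) = weighted_norm mu D theta p q f.
Proof.
rewrite /weighted_norm /amalgam_norm; congr (poweR _ _).
apply: eq_esum => alpha _; congr (poweR _ _).
rewrite /Lp_norm; congr (Lnorm _ _ _); congr (patch _ _ _).
by apply/funext => x; rewrite fctE mulNr normcN.
Qed.

Lemma weighted_normZ_le theta f (t : R) : borel_measurable f ->
  measurable_fun [set: borel G] (theta : borel G -> R) ->
  (forall x, 0 <= theta x) -> 0 <= t ->
  (weighted_norm mu D theta p q (fun x => f x * (t%:C)%C)%R <=
   t%:E * weighted_norm mu D theta p q f)%E.
Proof.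
move=> mf mt th0 t0; rewrite !weighted_normE//.
apply: le_trans (amalgamZ_le _ _ _ _ _ _ _) => //; last 2 first.
- by apply/measurable_EFinP; exact: (measurable_weighted mf).
- by move=> x; rewrite lee_fin mulr_ge0// normc_ge0.
under [X in (amalgam _ _ _ _ X <= _)%E]eq_fun.
  move=> x; rewrite normcM normc_real ger0_norm// mulrAC mulrC EFinM; over.
exact: lexx.
Qed.

Lemma weighted_norm_series theta f (h : nat -> G -> R[i]) :
  borel_measurable f -> (forall n, borel_measurable (h n)) ->
  measurable_fun [set: borel G] (theta : borel G -> R) ->
  (forall x, 0 <= theta x) ->
  (forall x, ((normc (f x))%:E <= \sum_(n <oo) (normc (h n x))%:E)%E) ->
  (weighted_norm mu D theta p q f <=
   \sum_(n <oo) weighted_norm mu D theta p q (h n))%E.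
Proof.
move=> mf mh mt t0 dom; rewrite weighted_normE//.
under eq_eseriesr do rewrite weighted_normE//.
apply: le_trans (amalgam_series_le _ _ _ _ _ _) => //; last 2 first.
- by move=> n; exact: measurable_weighted.
- by move=> n x; rewrite mulr_ge0// normc_ge0.
have nn n x : (0 <= (normc (h n x) * theta x)%:E)%E.
  by rewrite lee_fin mulr_ge0// normc_ge0.
apply: le_amalgam => //.
- by apply/measurable_EFinP; exact: (measurable_weighted mf).
- apply: (@ge0_emeasurable_sum _ _ _ _ (fun n (x : borel G) =>
    (normc (h n x) * theta x)%:E) xpredT) => // n _.
  by apply/measurable_EFinP; exact: measurable_weighted.
move=> x; rewrite lee_fin mulr_ge0 ?normc_ge0//=.
under eq_eseriesr do rewrite mulrC EFinM.
rewrite nneseriesZl; last by move=> n _; rewrite lee_fin normc_ge0.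
by rewrite mulrC EFinM; apply: lee_pmul; rewrite ?lee_fin ?normc_ge0.
Qed.

Definition truncated_weight theta (k : nat) (x : G) : R := Num.min (theta x) k%:R.

Lemma truncated_weight_ge0 theta k x : (forall x, 1 <= theta x) ->
  0 <= truncated_weight theta k x.
Proof. by move=> t1; rewrite le_min ler0n (le_trans ler01). Qed.

Lemma measurable_truncated_weight theta k :
  measurable_fun [set: borel G] (theta : borel G -> R) ->
  measurable_fun [set: borel G] (truncated_weight theta k : borel G -> R).
Proof. by move=> mt; apply: measurable_minr => //; exact: measurable_cst. Qed.

(** [min(theta, k) <= k <= k theta'], which makes the truncated norms continuous
for any norm with weight [theta'] at least [1]. *)
Lemma truncated_weight_norm_le theta theta' k f : borel_measurable f ->
  measurable_fun [set: borel G] (theta : borel G -> R) ->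
  measurable_fun [set: borel G] (theta' : borel G -> R) ->
  (forall x, 1 <= theta x) -> (forall x, 1 <= theta' x) ->
  (weighted_norm mu D (truncated_weight theta k) p q f <=
   k%:R%:E * weighted_norm mu D theta' p q f)%E.
Proof.
move=> mf mt mt' t1 t1'.
have t0 k' x := @truncated_weight_ge0 theta k' x t1.
have t0' x : 0 <= theta' x by apply: le_trans (t1' x).
rewrite !weighted_normE//.
apply: le_trans (amalgamZ_le _ _ _ _ _ _ _) => //; last 2 first.
- by apply/measurable_EFinP; exact: (measurable_weighted mf).
- by move=> x; rewrite lee_fin mulr_ge0// normc_ge0.
apply: le_amalgam => //.
- by apply/measurable_EFinP; apply: measurable_weighted => //;
    exact: measurable_truncated_weight.
- apply: measurable_funeM.
  by apply/measurable_EFinP; exact: measurable_weighted.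
move=> x; rewrite -EFinM !lee_fin mulr_ge0 ?normc_ge0 ?t0//=.
rewrite mulrCA ler_wpM2l ?normc_ge0//.
apply: (@le_trans _ _ k%:R); first by rewrite /truncated_weight ge_min lexx orbT.
by rewrite ler_peMr ?ler0n.
Qed.

(** The truncated weights increase to [theta], and are eventually equal to it at
each point. *)
Lemma truncated_weight_norm_fatou theta f M : borel_measurable f ->
  measurable_fun [set: borel G] (theta : borel G -> R) ->
  (forall x, 1 <= theta x) ->
  (forall k, weighted_norm mu D (truncated_weight theta k) p q f <= M)%E ->
  (weighted_norm mu D theta p q f <= M)%E.
Proof.
move=> mf mt t1 hM.
have t0 k x := @truncated_weight_ge0 theta k x t1.
rewrite weighted_normE; last by move=> x; apply: le_trans (t1 x).
apply: (@amalgam_fatou _ _ _ _ _ _ _ _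
  (fun k x => (normc (f x) * truncated_weight theta k x)%:E)) => //.
- by move=> k; apply/measurable_EFinP; apply: measurable_weighted => //;
    exact: measurable_truncated_weight.
- by move=> k x; rewrite lee_fin mulr_ge0 ?normc_ge0.
- move=> x k l kl; rewrite lee_fin ler_wpM2l ?normc_ge0//.
  by rewrite /truncated_weight le_min ge_min lexx/= ge_min ler_nat kl orbT.
- move=> x; apply: cvg_near_cst; near=> k.
  rewrite /truncated_weight min_l//.
  have : (Num.truncn (theta x) < k)%N by near: k; exact: nbhs_infty_gt.
  by move=> trk; apply/ltW/(lt_le_trans (truncnS_gt _)); rewrite ler_nat.
- by move=> k; rewrite -weighted_normE.
Unshelve. all: by end_near. Qed.

End WeightedNorm.

(** * Absolutely convergent series of functions *)

Section ComplexSeries.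
Context {R : realType}.

Lemma normc_sum_le (I : Type) (r : seq I) (F : I -> R[i]) :
  normc (\sum_(i <- r) F i) <= \sum_(i <- r) normc (F i).
Proof.
elim: r => [|i r IHr]; first by rewrite !big_nil normc0.
by rewrite !big_cons; apply: le_trans (le_normcD _ _) _; rewrite lerD2l.
Qed.

Lemma normc_le_lim (z : nat -> R[i]) (l : R[i]) (T : R) :
  (forall b, cpart b (z n) @[n --> \oo] --> cpart b l) ->
  (\forall n \near \oo, normc (z n) <= T) -> normc l <= T.
Proof.
move=> zl zT.
have nE (w : R[i]) : normc w = Num.sqrt (cpart true w * cpart true w +
    cpart false w * cpart false w).
  by case: w => a b /=; rewrite !expr2.
have cn : normc (z n) @[n --> \oo] --> normc l.
  under eq_fun do rewrite nE; rewrite nE.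
  apply: continuous_cvg; first exact: sqrt_continuous.
  by apply: cvgD; apply: cvgM; exact: zl.
by rewrite -(cvg_lim _ cn)//; apply: limr_le => //; apply/cvg_ex; exists (normc l).
Qed.

(** An infinite right side makes the estimate trivial; otherwise it is the limit of
the estimates for partial sums. *)
Lemma series_tail_le (a : nat -> R[i]) (l : R[i]) :
  (forall b, cpart b (\sum_(i < n) a i) @[n --> \oo] --> cpart b l) ->
  forall n, ((normc (l - \sum_(i < n) a i))%:E <=
             \sum_(n <= m <oo) (normc (a m))%:E)%E.
Proof.
move=> al n.
have T0 : (0 <= \sum_(n <= m <oo) (normc (a m))%:E)%E.
  by apply: nneseries_ge0 => m _ _; rewrite lee_fin normc_ge0.
case ET : (\sum_(n <= m <oo) (normc (a m))%:E)%E T0 => [T| |]// _; last first.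
  by rewrite leey.
rewrite lee_fin.
apply: (@normc_le_lim (fun N => \sum_(i < N) a i - \sum_(i < n) a i)).
  move=> b; rewrite cpartB; under eq_fun do rewrite cpartB.
  by apply: cvgB; [exact: al|exact: cvg_cst].
near=> N.
have nN : (n <= N)%N by near: N; exact: nbhs_infty_ge.
rewrite -!(big_mkord xpredT) (big_cat_nat (leq0n n) nN)/= addrAC subrr add0r.
apply: le_trans (normc_sum_le _ _) _; rewrite -lee_fin -ET -sumEFin.
by apply: nneseries_lim_ge => m _ _; rewrite lee_fin normc_ge0.
Unshelve. all: by end_near. Qed.

Context {G : topologicalZmodType}.
Implicit Types f g : G -> R[i].

Lemma borel_measurable_sum (g : nat -> G -> R[i]) n :
  (forall n, borel_measurable (g n)) -> borel_measurable (\sum_(i < n) g i).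
Proof.
move=> mg; elim: n => [|n IHn]; first by rewrite big_ord0; exact: borel_measurable0.
by rewrite big_ord_recr/=; exact: borel_measurableD.
Qed.

(** The sum is set to [0] where [sum_m |g_m|] is infinite.  At those points every tail
of that series is infinite as well, so the estimate holds everywhere and not only
almost everywhere. *)
Lemma pointwise_series (g : nat -> G -> R[i]) :
  (forall n, borel_measurable (g n)) ->
  exists2 s, borel_measurable s & forall x n,
    ((normc (s x - \sum_(i < n) g i x))%:E <=
     \sum_(n <= m <oo) (normc (g m x))%:E)%E.
Proof.
move=> mg; pose u (x : borel G) : \bar R := (\sum_(m <oo) (normc (g m x))%:E)%E.
have mum : measurable_fun [set: borel G] u.
  apply: (@ge0_emeasurable_sum _ _ _ _ (fun n (x : borel G) => (normc (g n x))%:E)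
    xpredT) => [n x _ _|n _]; first by rewrite lee_fin normc_ge0.
  by apply/measurable_EFinP; exact: measurable_normc.
pose E : set (borel G) := [set x | u x != +oo%E].
have mE : measurable E.
  rewrite -[E]setTI; apply: emeasurable_neq => //; exact: measurable_cst.
pose h b n : borel G -> R := (fun x => cpart b (\sum_(i < n) g i x)) \_ E.
have hcvg b x : cvgn (fun n => h b n x).
  have [xE|nxE] := boolP (x \in E); last first.
    suff -> : (fun n => h b n x) = (fun=> 0) by exact: is_cvg_cst.
    by apply/funext => n; rewrite /h /patch (negbTE nxE).
  have -> : (fun n => h b n x) = (fun n => cpart b (\sum_(i < n) g i x)).
    by apply/funext => n; rewrite /h /patch xE.
  move: xE; rewrite inE /E/= => ux.
  have ufin : u x \is a fin_num.
    rewrite ge0_fin_numE ?lt_neqAle ?ux ?leey//.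
    by apply: nneseries_ge0 => n _ _; rewrite lee_fin normc_ge0.
  have -> : (fun n => cpart b (\sum_(i < n) g i x)) = series (fun i => cpart b (g i x)).
    by apply/funext => n; rewrite cpart_sum /series/= big_mkord.
  apply: normed_cvg; apply: nondecreasing_is_cvgn.
    by apply: nondecreasing_series => k _ _; exact: normr_ge0.
  exists (fine (u x)) => _ [n _ <-]; rewrite -lee_fin fineK//.
  rewrite /series/= -sumEFin.
  apply: (@le_trans _ _ (\sum_(0 <= k < n) (normc (g k x))%:E)%E).
    by apply: lee_sum => k _; rewrite lee_fin cpart_le_normc.
  by apply: nneseries_lim_ge => k _ _; rewrite lee_fin normc_ge0.
pose s (x : G) : R[i] := (limn (fun n => h true n x) +i* limn (fun n => h false n x))%C.
have sE b x : cpart b (s x) = limn (fun n => h b n x) by case: b.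
exists s.
  apply/borel_measurableP => b.
  apply: (@measurable_fun_cvg _ _ _ _ (h b)) => [n|x _].
    apply: (@measurable_restrictT _ _ _ _ _ _ mE).1; apply: measurable_funTS.
    have /borel_measurableP/(_ b) := borel_measurable_sum n mg.
    by rewrite fct_sumE.
  by rewrite sE; exact: hcvg.
move=> x n; have [xE|nxE] := pselect (E x); last first.
  have uoo : u x = +oo%E by apply/eqP; apply: contra_notT nxE.
  have := uoo; rewrite /u (nneseries_split 0 n); last first.
    by move=> k _; rewrite lee_fin normc_ge0.
  rewrite add0n sumEFin => /eqP; rewrite addeC; case: (\sum_(n <= _ <oo) _)%E => //.
  by rewrite leey.
apply: (@series_tail_le (fun i => g i x)) => b; rewrite sE.
suff -> : (fun n => cpart b (\sum_(i < n) g i x)) = (fun n => h b n x) by exact: hcvg.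
by apply/funext => k; rewrite /h /patch mem_set.
Qed.

End ComplexSeries.

(** * The Fourier transform on integrable functions *)

Section Fourier.
Context {R : realType} {G : topologicalZmodType}.
Variable (mu : {measure set (borel G) -> \bar R}).
Implicit Types (f g : G -> R[i]) (gamma : dual R G).

Definition L1 f : Prop := borel_measurable f /\
  (\int[mu]_(x in [set: borel G]) (normc (f x))%:E < +oo)%E.

Lemma normc_dual gamma x : normc ((gamma : G -> R[i]) x)^*%C = 1.
Proof.
have : `|(gamma x)^*%C| = 1 by rewrite normcJ dual_norm.
by rewrite normc_normr => -[].
Qed.

Lemma continuous_cpart_dual gamma b : continuous (fun x : G => cpart b (gamma x)).
Proof.
move=> x; apply/cvgrPdist_lt => e e0.
have := @dual_continuous R G gamma x.
move=> /cvgrPdist_lt/(_ (e%:C)%C); rewrite ltcR => /(_ e0); apply: filterS => y.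
rewrite normc_normr ltcR -cpartB; apply: le_lt_trans; exact: cpart_le_normc.
Qed.

Lemma measurable_fourier_kernel f gamma : borel_measurable f ->
  borel_measurable (fun x => f x * ((gamma : G -> R[i]) x)^*%C).
Proof.
move=> /borel_measurableP mf.
have mg b := continuous_borel (@continuous_cpart_dual gamma b).
apply/borel_measurableP => -[].
- have -> : (fun x : borel G => cpart true (f x * (gamma x)^*%C)) =
    (fun x => cpart true (f x) * cpart true (gamma x) +
              cpart false (f x) * cpart false (gamma x)).
    by apply/funext => x; case: (f x) (gamma x) => a b [c d]/=; ring.
  by apply: measurable_funD; apply: measurable_funM.
- have -> : (fun x : borel G => cpart false (f x * (gamma x)^*%C)) =
    (fun x => cpart false (f x) * cpart true (gamma x) -
              cpart true (f x) * cpart false (gamma x)).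
    by apply/funext => x; case: (f x) (gamma x) => a b [c d]/=; ring.
  by apply: measurable_funB; apply: measurable_funM.
Qed.

Lemma fourier_cpart b f gamma : cpart b (fourier mu f gamma) =
  Rintegral mu [set: borel G]
    (fun x => cpart b (f x * ((gamma : G -> R[i]) x)^*%C)).
Proof. by case: b. Qed.

Lemma L1_integrable b f gamma : L1 f -> mu.-integrable [set: borel G]
  (EFin \o (fun x : borel G => cpart b (f x * ((gamma : G -> R[i]) x)^*%C))).
Proof.
move=> [mf fi]; have /borel_measurableP/(_ b) mk := measurable_fourier_kernel gamma mf.
apply/integrableP; split; first exact/measurable_EFinP.
apply: le_lt_trans fi; apply: ge0_le_integral => //.
- by apply: measurableT_comp => //; exact/measurable_EFinP.
- by apply/measurable_EFinP; exact: measurable_normc.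
- move=> x _; rewrite /= lee_fin; apply: le_trans (cpart_le_normc _ _) _.
  by rewrite normcM normc_dual mulr1.
Qed.

Lemma fourierD f g gamma : L1 f -> L1 g ->
  fourier mu (f + g) gamma = fourier mu f gamma + fourier mu g gamma.
Proof.
move=> Lf Lg; apply: cpart_inj => b; rewrite cpartD !fourier_cpart.
rewrite -RintegralD//; [|exact: L1_integrable..].
by apply: eq_Rintegral => x _; rewrite -cpartD -mulrDl.
Qed.

Lemma fourierZ f (t : R) gamma : L1 f ->
  fourier mu (fun x => f x * (t%:C)%C) gamma = fourier mu f gamma * (t%:C)%C.
Proof.
move=> Lf; apply: cpart_inj => b; rewrite cpartZ !fourier_cpart.
rewrite -RintegralZr//; last exact: L1_integrable.
by apply: eq_Rintegral => x _; rewrite mulrAC cpartZ.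
Qed.

Lemma fourier0 gamma : fourier mu 0 gamma = 0.
Proof.
apply: cpart_inj => b; rewrite cpart0 fourier_cpart.
rewrite /Rintegral; under eq_integral do rewrite mul0r cpart0.
by rewrite integral0.
Qed.

Lemma L10 : L1 0.
Proof.
split; first exact: borel_measurable0.
by under eq_integral do rewrite normc0; rewrite integral0 ltry.
Qed.

Lemma L1N f : L1 f -> L1 (- f).
Proof.
move=> [mf fi]; split; first exact: borel_measurableN.
by under eq_integral do rewrite fctE normcN.
Qed.

Lemma L1D f g : L1 f -> L1 g -> L1 (f + g).
Proof.
move=> [mf fi] [mg gi]; split; first exact: borel_measurableD.
have n0 (h : G -> R[i]) x : (0 <= (normc (h x))%:E)%E by rewrite lee_fin normc_ge0.
have mn h : borel_measurable h ->
    measurable_fun [set: borel G] (fun x : borel G => (normc (h x))%:E).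
  by move=> mh; apply/measurable_EFinP; exact: measurable_normc.
apply: (@le_lt_trans _ _ (\int[mu]_(x in [set: borel G])
    ((normc (f x))%:E + (normc (g x))%:E))%E).
  apply: ge0_le_integral => //.
  - by apply: mn; exact: borel_measurableD.
  - by apply: emeasurable_funD; exact: mn.
  - by move=> x _; rewrite lee_fin; exact: le_normcD.
rewrite ge0_integralD//; [|exact: mn..].
exact: lte_add_pinfty.
Qed.

Lemma fourierN f gamma : L1 f -> fourier mu (- f) gamma = - fourier mu f gamma.
Proof.
move=> Lf; apply/eqP; rewrite -addr_eq0 -fourierD//; last exact: L1N.
by rewrite addNr fourier0.
Qed.

Lemma L1_sum (g : nat -> G -> R[i]) n : (forall n, L1 (g n)) -> L1 (\sum_(i < n) g i).
Proof.
move=> Lg; elim: n => [|n IHn]; first by rewrite big_ord0; exact: L10.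
by rewrite big_ord_recr/=; exact: L1D.
Qed.

Lemma fourier_sum (g : nat -> G -> R[i]) n gamma : (forall n, L1 (g n)) ->
  fourier mu (\sum_(i < n) g i) gamma = \sum_(i < n) fourier mu (g i) gamma.
Proof.
move=> Lg; elim: n => [|n IHn]; first by rewrite !big_ord0 fourier0.
by rewrite !big_ord_recr/= fourierD ?IHn//; exact: L1_sum.
Qed.

Lemma fourier_le b f gamma : L1 f ->
  ((`|cpart b (fourier mu f gamma)|)%:E <=
   \int[mu]_(x in [set: borel G]) (normc (f x))%:E)%E.
Proof.
move=> Lf; have [mf _] := Lf.
rewrite fourier_cpart EFin_normr_Rintegral//; last exact: L1_integrable.
have /borel_measurableP/(_ b) mk := measurable_fourier_kernel gamma mf.
apply: le_trans (le_abse_integral _ _ _) _ => //; first exact/measurable_EFinP.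
apply: ge0_le_integral => //.
- by apply: measurableT_comp => //; exact/measurable_EFinP.
- by apply/measurable_EFinP; exact: measurable_normc.
- move=> x _; rewrite /= lee_fin; apply: le_trans (cpart_le_normc _ _) _.
  by rewrite normcM normc_dual mulr1.
Qed.

(** The transform is bounded by the [L^1] norm, and the [L^1] norm of
[s - sum_(i < n) g_i] is at most the tail of a convergent series. *)
Lemma fourier_series (g : nat -> G -> R[i]) s :
  (forall n, L1 (g n)) ->
  (\sum_(n <oo) \int[mu]_(x in [set: borel G]) (normc (g n x))%:E < +oo)%E ->
  borel_measurable s ->
  (forall x n, ((normc (s x - \sum_(i < n) g i x))%:E <=
     \sum_(n <= m <oo) (normc (g m x))%:E)%E) ->
  L1 s /\ forall gamma b,
    cpart b (\sum_(i < n) fourier mu (g i) gamma) @[n --> \oo] -->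
    cpart b (fourier mu s gamma).
Proof.
move=> Lg gfin ms tail.
pose I f := (\int[mu]_(x in [set: borel G]) (normc (f x))%:E)%E.
have mn h : borel_measurable h ->
    measurable_fun [set: borel G] (fun x : borel G => (normc (h x))%:E).
  by move=> mh; apply/measurable_EFinP; exact: measurable_normc.
have n0 (h : G -> R[i]) x : (0 <= (normc (h x))%:E)%E by rewrite lee_fin normc_ge0.
have I0 f : (0 <= I f)%E by apply: integral_ge0 => x _; exact: n0.
have mg n : borel_measurable (g n) by have [] := Lg n.
have md n : borel_measurable (s - \sum_(i < n) g i).
  by apply: borel_measurableD => //; apply/borel_measurableN/borel_measurable_sum.
have tailI n : (I (s - \sum_(i < n) g i)%R <= \sum_(n <= m <oo) I (g m))%E.
  have -> : (\sum_(n <= m <oo) I (g m) =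
      \int[mu]_(x in [set: borel G]) \sum_(k <oo) (normc (g (k + n)%N x))%:E)%E.
    rewrite integral_nneseries//; last by move=> k; exact: mn.
    by rewrite (nneseries_addn n (f := fun m => I (g m))).
  apply: ge0_le_integral => //.
  - exact: mn.
  - apply: (@ge0_emeasurable_sum _ _ _ _
      (fun k (x : borel G) => (normc (g (k + n)%N x))%:E) xpredT) => // k _.
    exact: mn.
  - move=> x _; rewrite (nneseries_addn n (f := fun m => (normc (g m x))%:E))//.
    by have := tail x n; rewrite fct_sumE.
have Ls : L1 s.
  split => //; apply: le_lt_trans gfin.
  by have := tailI 0%N; rewrite big_ord0 subr0.
split => // gamma b.
have dE n : cpart b (\sum_(i < n) fourier mu (g i) gamma) =
    cpart b (fourier mu s gamma) -
    cpart b (fourier mu (s - \sum_(i < n) g i) gamma).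
  have LS := L1_sum n Lg.
  by rewrite fourierD//; [rewrite fourierN// fourier_sum// -cpartB subKr|exact: L1N].
under eq_fun do rewrite dE.
suff h : cpart b (fourier mu (s - \sum_(i < n) g i) gamma) @[n --> \oo] --> (0 : R).
  have := cvgB (cvg_cst (cpart b (fourier mu s gamma))) h.
  by rewrite subr0; apply.
apply/norm_cvg0P.
suff : (EFin \o (fun n => `|cpart b (fourier mu (s - \sum_(i < n) g i) gamma)|))
    @ \oo --> 0%:E by move=> /fine_cvg.
apply: (@squeeze_cvge _ _ _ _ (fun=> 0%E) _
  (fun n => (\sum_(n <= m <oo) I (g m))%E)).
- near=> n; rewrite /= lee_fin normr_ge0/=; apply: le_trans (tailI n).
  apply: fourier_le; apply: L1D => //; apply: L1N; exact: L1_sum.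
- exact: cvg_cst.
- exact: nneseries_tail_cvg.
Unshelve. all: by end_near. Qed.

End Fourier.

(** * Amalgam spaces with a weight bounded below *)

Section AmalgamSpace.
Context {R : realType} {G : topologicalZmodType}.
Variables (mu : {measure set (borel G) -> \bar R}) (D : lca_decomposition R G).
Variables (p q : R) (p1 : 1 <= p) (q1 : 1 <= q).
Variables (theta : G -> R).
Hypotheses (mtheta : measurable_fun [set: borel G] (theta : borel G -> R)).
Hypotheses (theta1 : forall x, 1 <= theta x).

Let theta0 x : 0 <= theta x. Proof. exact: le_trans (theta1 x). Qed.
Let p0 : 0 < p. Proof. exact: lt_le_trans p1. Qed.

Lemma amalgam_le_weighted (f : G -> R[i]) : borel_measurable f ->
  (amalgam mu D p q (fun x => (normc (f x))%:E) <=
   weighted_norm mu D theta p q f)%E.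
Proof.
move=> mf; rewrite weighted_normE//; apply: le_amalgam => //.
- by apply/measurable_EFinP; exact: measurable_normc.
- by apply/measurable_EFinP; exact: measurable_weighted.
- by move=> x; rewrite !lee_fin normc_ge0 ler_peMr ?normc_ge0.
Qed.

(** Local integrability follows from finiteness of the weighted norm: a compact set
is covered by finitely many cells, and on each of them the [L^p] norm is at most
the weighted norm, the weight being at least [1]. *)
Lemma amalgam_spaceP (f : G -> R[i]) : hausdorff_space G ->
  amalgam_space mu D theta p q f <->
  borel_measurable f /\ (weighted_norm mu D theta p q f < +oo)%E.
Proof.
move=> hG; split=> [[[mf _] fW]|[mf fW]]; split=> //; split => // K cK.
have [F [finF FL] KF] := compact_cells D cK.
pose u (x : borel G) : \bar R := ((normc (f x)) `^ p)%:E.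
have u0 x : (0 <= u x)%E by rewrite lee_fin powR_ge0.
have mum : measurable_fun [set: borel G] u.
  apply/measurable_EFinP; apply: (measurableT_comp (measurable_powR p)).
  exact: measurable_normc.
have uA (A : set (borel G)) x : (0 <= (u \_ A) x)%E by rewrite /patch; case: ifP.
rewrite integral_mkcond.
apply: (@le_lt_trans _ _ (\int[mu]_(x in [set: borel G])
    \sum_(alpha <- fset_set F) (u \_ (cell D alpha)) x)%E).
  apply: ge0_le_integral => //.
  - have mK : measurable (K : set (borel G)) by exact: borel_compact.
    apply: (@measurable_restrictT _ _ _ _ _ u mK).1; exact: measurable_funTS.
  - apply: (@emeasurable_sum _ (borel G) R setT _ (fset_set F)
      (fun alpha (x : borel G) => (u \_ (cell D alpha)) x)) => alpha.
    exact: measurable_restrict_cell.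
  - move=> x _; rewrite {1}/patch; case: ifPn => [|_]; last first.
      by apply: sume_ge0 => alpha _; exact: uA.
    rewrite inE => /KF[alpha Fa ax].
    rewrite (big_fsetD1 alpha) ?in_fset_set ?inE//=.
    rewrite {1}/patch mem_set// leeDl//.
    by apply: sume_ge0 => b _; exact: uA.
rewrite ge0_integral_sum//; last first.
  by move=> alpha; exact: measurable_restrict_cell.
rewrite big_seq; apply: lte_sum_pinfty => alpha.
rewrite in_fset_set// inE => /FL La.
have pn0 : p != 0 by rewrite gt_eqF.
have := poweR_Lnorm mu ((fun x : borel G => (normc (f x))%:E) \_ (cell D alpha)) pn0.
have -> : (\int[mu]_(x in [set: borel G]) (u \_ (cell D alpha)) x =
  \int[mu]_(x in [set: borel G])
    `|((fun x : borel G => (normc (f x))%:E) \_ (cell D alpha)) x| `^ p)%E.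
  apply: eq_integral => x _; rewrite /patch; case: ifP => _.
    by rewrite gee0_abs ?lee_fin ?normc_ge0.
  by rewrite abse0 poweR0r.
move=> <-; apply: poweR_lty; apply: le_lt_trans fW.
apply: le_trans (amalgam_le_weighted mf).
exact: Lnorm_cell_le_amalgam.
Qed.

Lemma weighted_norm_tail (f : G -> R[i]) (h : nat -> G -> R[i]) n :
  borel_measurable f -> (forall n, borel_measurable (h n)) ->
  (forall x, ((normc (f x))%:E <= \sum_(n <= m <oo) (normc (h m x))%:E)%E) ->
  (weighted_norm mu D theta p q f <=
   \sum_(n <= m <oo) weighted_norm mu D theta p q (h m))%E.
Proof.
move=> mf mh dom.
rewrite -nneseries_addn; last by move=> m; exact: weighted_norm_ge0.
apply: (@weighted_norm_series _ _ _ _ _ _ _ _ _ _ (fun k => h (k + n)%N)) => // x.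
rewrite (nneseries_addn n (f := fun m => (normc (h m x))%:E))//.
by move=> k; rewrite lee_fin normc_ge0.
Qed.

Lemma truncated_weight_norm_mono k (f : G -> R[i]) : borel_measurable f ->
  (weighted_norm mu D (truncated_weight theta k) p q f <=
   weighted_norm mu D theta p q f)%E.
Proof.
move=> mf; apply: le_weighted_norm => //; first exact: measurable_truncated_weight.
- by move=> x; exact: truncated_weight_ge0.
- by move=> x; rewrite ler_wpM2l ?normc_ge0// /truncated_weight ge_min lexx.
Qed.

End AmalgamSpace.

(** * The spaces with conditions on a function and on its transform *)

Section FourierAmalgam.
Context {R : realType} {G : topologicalZmodType}.
Variables (mu : {measure set (borel G) -> \bar R}) (D : lca_decomposition R G).
Variables (nu : {measure set (borel (dual R G)) -> \bar R})
  (Dhat : lca_decomposition R (dual R G)).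
Hypotheses (hausG : hausdorff_space G) (haar_mu : is_haar mu).
Hypothesis (mu1 : mu (unit_cell D) = 1%E).
Variables (p q r : R) (p1 : 1 <= p) (q1 : 1 <= q) (r1 : 1 <= r).

Section OneSpace.
Variables (theta : G -> R) (omega : dual R G -> R).
Hypotheses (wtheta : beurling_weight mu theta) (womega : beurling_weight nu omega).

Let mt := beurling_measurable wtheta.
Let mo := beurling_measurable womega.
Let t1 := beurling_ge1 wtheta.
Let o1 := beurling_ge1 womega.
Let t0 x : 0 <= theta x. Proof. exact: le_trans (t1 x). Qed.
Let o0 x : 0 <= omega x. Proof. exact: le_trans (o1 x). Qed.

Local Notation A := (A_space mu D nu Dhat p 1 q r theta omega).
Local Notation N := (A_norm mu D nu Dhat p 1 q r theta omega).
Local Notation Wt := (weighted_norm mu D theta p 1).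
Local Notation Wo := (weighted_norm nu Dhat omega q r).

Lemma A_spaceP (f : G -> R[i]) : A f <->
  [/\ borel_measurable f, (Wt f < +oo)%E, borel_measurable (fourier mu f) &
      (Wo (fourier mu f) < +oo)%E].
Proof.
have h1 := amalgam_spaceP mu D p1 (lexx 1) mt t1 f hausG.
have h2 := amalgam_spaceP nu Dhat q1 r1 mo o1 (fourier mu f) (@dual_hausdorff R G).
by split=> [[/h1[? ?] /h2[? ?]]|[? ? ? ?]]; split=> //; [exact/h1|exact/h2].
Qed.

Lemma integral_le_weighted (f : G -> R[i]) : borel_measurable f ->
  (\int[mu]_(x in [set: borel G]) (normc (f x))%:E <= Wt f)%E.
Proof.
move=> mf; apply: le_trans (amalgam_le_weighted mu D p1 (lexx 1) mt t1 mf).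
apply: integral_le_amalgam => //; first exact: measurable_normc.
by move=> x; exact: normc_ge0.
Qed.

Lemma A_space_L1 (f : G -> R[i]) : A f -> L1 mu f.
Proof.
move=> /A_spaceP[mf fW _ _]; split=> //.
exact: le_lt_trans (integral_le_weighted mf) fW.
Qed.

Lemma A_norm_ge0 (f : G -> R[i]) : (0 <= N f)%E.
Proof. by rewrite adde_ge0// weighted_norm_ge0. Qed.

Lemma A_norm_fin (f : G -> R[i]) : A f -> (N f < +oo)%E.
Proof. by move=> /A_spaceP[_ ? _ ?]; exact: lte_add_pinfty. Qed.

Lemma A_fourierD (f g : G -> R[i]) : A f -> A g ->
  fourier mu (f + g) = fourier mu f + fourier mu g.
Proof.
by move=> /A_space_L1 Lf /A_space_L1 Lg; apply/funext => gamma; rewrite fourierD.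
Qed.

Lemma A_fourierN (f : G -> R[i]) : A f -> fourier mu (- f) = - fourier mu f.
Proof. by move=> /A_space_L1 Lf; apply/funext => gamma; rewrite fourierN. Qed.

Lemma A_fourierZ (f : G -> R[i]) (t : R) : A f ->
  fourier mu (fun x => f x * (t%:C)%C) = (fun x => fourier mu f x * (t%:C)%C).
Proof. by move=> /A_space_L1 Lf; apply/funext => gamma; rewrite fourierZ. Qed.

Lemma A_fourier_sum (g : nat -> G -> R[i]) n : (forall n, A (g n)) ->
  fourier mu (\sum_(i < n) g i) = \sum_(i < n) fourier mu (g i).
Proof.
move=> Ag; apply/funext => gamma; rewrite fourier_sum ?fct_sumE// => k.
exact: A_space_L1.
Qed.

Lemma A_spaceN (f : G -> R[i]) : A f -> A (- f).
Proof.
move=> Af; apply/A_spaceP; rewrite A_fourierN// !weighted_normN.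
have /A_spaceP[? ? ? ?] := Af.
by split => //; exact: borel_measurableN.
Qed.

Lemma A_spaceD (f g : G -> R[i]) : A f -> A g -> A (f + g).
Proof.
move=> Af Ag; apply/A_spaceP; rewrite A_fourierD//.
have /A_spaceP[mf fW mFf FfW] := Af; have /A_spaceP[mg gW mFg FgW] := Ag.
split; [exact: borel_measurableD| |exact: borel_measurableD|].
- apply: le_lt_trans (lte_add_pinfty fW gW); exact: weighted_normD.
- apply: le_lt_trans (lte_add_pinfty FfW FgW); exact: weighted_normD.
Qed.

Lemma A_space0 : A 0.
Proof.
have F0 : fourier mu (0 : G -> R[i]) = 0 by apply/funext => ?; exact: fourier0.
by apply/A_spaceP; rewrite F0 !weighted_norm0.
Qed.

Lemma A_spaceZ (f : G -> R[i]) (t : R) : 0 <= t -> A f ->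
  A (fun x => f x * (t%:C)%C).
Proof.
move=> t_ge0 Af; apply/A_spaceP; rewrite A_fourierZ//.
have /A_spaceP[mf fW mFf FfW] := Af.
split; [exact: borel_measurableZ| |exact: borel_measurableZ|].
- apply: le_lt_trans (weighted_normZ_le _ _ _ _ _ _ _ _) _ => //.
  by rewrite lte_mul_pinfty.
- apply: le_lt_trans (weighted_normZ_le _ _ _ _ _ _ _ _) _ => //.
  by rewrite lte_mul_pinfty.
Qed.

Lemma A_normZ_le (f : G -> R[i]) (t : R) : 0 <= t -> A f ->
  (N (fun x => f x * (t%:C)%C)%R <= t%:E * N f)%E.
Proof.
move=> t_ge0 Af; rewrite /A_norm A_fourierZ//.
have /A_spaceP[mf fW mFf FfW] := Af.
rewrite muleDr ?ge0_adde_def ?inE ?weighted_norm_ge0//.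
by apply: leeD; exact: weighted_normZ_le.
Qed.

(** The pointwise sum of the series works for both norms: the functions and their
transforms satisfy the same tail estimate, the latter because the series also
converges absolutely in [L^1]. *)
Lemma A_complete (g : nat -> G -> R[i]) : (forall n, A (g n)) ->
  (\sum_(n <oo) N (g n) < +oo)%E ->
  exists2 s, A s & forall n,
    (N (s - \sum_(i < n) g i)%R <= \sum_(n <= m <oo) N (g m))%E.
Proof.
move=> Ag gfin.
have mg n : borel_measurable (g n) by have /A_spaceP[] := Ag n.
have mFg n : borel_measurable (fourier mu (g n)) by have /A_spaceP[] := Ag n.
have NE n : (\sum_(n <= m <oo) N (g m) =
    \sum_(n <= m <oo) Wt (g m) + \sum_(n <= m <oo) Wo (fourier mu (g m)))%E.
  by rewrite nneseriesD// => m _ _; exact: weighted_norm_ge0.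
have Wtfin : (\sum_(n <oo) Wt (g n) < +oo)%E.
  apply: le_lt_trans gfin; rewrite NE leeDl//.
  by apply: nneseries_ge0 => m _ _; exact: weighted_norm_ge0.
have Wofin : (\sum_(n <oo) Wo (fourier mu (g n)) < +oo)%E.
  apply: le_lt_trans gfin; rewrite NE leeDr//.
  by apply: nneseries_ge0 => m _ _; exact: weighted_norm_ge0.
have Lg n : L1 mu (g n) by exact: A_space_L1.
have [s ms stail] := pointwise_series mg.
have Ifin : (\sum_(n <oo) \int[mu]_(x in [set: borel G]) (normc (g n x))%:E < +oo)%E.
  apply: le_lt_trans Wtfin; apply: lee_nneseries => n *; last exact: integral_le_weighted.
  by apply: integral_ge0 => x _; rewrite lee_fin normc_ge0.
have [Ls Fcvg] := fourier_series Lg Ifin ms stail.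
have Ftail gamma n :=
  series_tail_le (a := fun i => fourier mu (g i) gamma) (Fcvg gamma) n.
have mFs : borel_measurable (fourier mu s).
  apply/borel_measurableP => b.
  apply: (@measurable_fun_cvg _ (borel (dual R G)) R setT
    (fun n (gamma : borel (dual R G)) =>
       cpart b (\sum_(i < n) fourier mu (g i) gamma))) => [n|gamma _].
    have /borel_measurableP/(_ b) := borel_measurable_sum n mFg.
    by rewrite fct_sumE.
  exact: Fcvg.
have sW n : (Wt (s - \sum_(i < n) g i)%R <= \sum_(n <= m <oo) Wt (g m))%E.
  apply: weighted_norm_tail => //.
    by apply: borel_measurableD => //; apply/borel_measurableN/borel_measurable_sum.
  by move=> x; have := stail x n; rewrite fctE fct_sumE.
have FsW n : (Wo (fourier mu s - \sum_(i < n) fourier mu (g i))%R <=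
    \sum_(n <= m <oo) Wo (fourier mu (g m)))%E.
  apply: (@weighted_norm_tail _ _ _ _ _ _ _ _ _ _ _ _ (fun m => fourier mu (g m)))
    => //.
    apply: borel_measurableD => //; apply: borel_measurableN.
    exact: (borel_measurable_sum n mFg).
  by move=> gamma; have := Ftail gamma n; rewrite fctE fct_sumE.
have As : A s.
  apply/A_spaceP; split => //.
  - by apply: le_lt_trans Wtfin; have := sW 0%N; rewrite big_ord0 subr0.
  - by apply: le_lt_trans Wofin; have := FsW 0%N; rewrite big_ord0 subr0.
exists s => // n; rewrite NE /A_norm.
have -> : fourier mu (s - \sum_(i < n) g i) =
    fourier mu s - \sum_(i < n) fourier mu (g i).
  rewrite -A_fourier_sum//; apply/funext => gamma.
  by rewrite fourierD ?fourierN//; [exact: L1_sum|apply: L1N; exact: L1_sum].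
exact: leeD.
Qed.

End OneSpace.

Variables (theta1 theta3 : G -> R) (theta2 theta4 : dual R G -> R).
Hypotheses (w1 : beurling_weight mu theta1) (w3 : beurling_weight mu theta3).
Hypotheses (w2 : beurling_weight nu theta2) (w4 : beurling_weight nu theta4).

Local Notation A12 := (A_space mu D nu Dhat p 1 q r theta1 theta2).
Local Notation A34 := (A_space mu D nu Dhat p 1 q r theta3 theta4).
Local Notation N12 := (A_norm mu D nu Dhat p 1 q r theta1 theta2).
Local Notation N34 := (A_norm mu D nu Dhat p 1 q r theta3 theta4).

Definition truncated_norm (k : nat) (f : G -> R[i]) : \bar R :=
  A_norm mu D nu Dhat p 1 q r (truncated_weight theta3 k) (truncated_weight theta4 k) f.

(** The inclusion provides the pointwise bound: a truncated norm is at most the norm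
of the target space. *)
Lemma truncated_norm_bounded : A12 `<=` A34 ->
  exists2 d : R, 0 < d &
    exists M : R, forall f k, A12 f -> (N12 f <= d%:E)%E ->
      (truncated_norm k f <= M%:E)%E.
Proof.
move=> sub.
have m3 := beurling_measurable w3; have m4 := beurling_measurable w4.
have m1 := beurling_measurable w1; have m2 := beurling_measurable w2.
have g1 := beurling_ge1 w1; have g2 := beurling_ge1 w2.
have g3 := beurling_ge1 w3; have g4 := beurling_ge1 w4.
apply: (@uniform_boundedness R (G -> R[i]) A12 N12 nat truncated_norm
  (fun k => k%:R)).
- exact: A_space0.
- by move=> f g Af Ag; exact: (A_spaceD w1 w2 Af (A_spaceN w1 w2 Ag)).
- move=> k f g Af Ag; rewrite /truncated_norm /A_norm (A_fourierD w1 w2 Af Ag).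
  have /(A_spaceP w1 w2)[mf _ mFf _] := Af; have /(A_spaceP w1 w2)[mg _ mFg _] := Ag.
  rewrite addeACA; apply: leeD; apply: weighted_normD => //.
  + exact: measurable_truncated_weight.
  + by move=> x; exact: truncated_weight_ge0.
  + exact: measurable_truncated_weight.
  + by move=> x; exact: truncated_weight_ge0.
- by move=> k f Af; rewrite /truncated_norm /A_norm (A_fourierN w1 w2 Af) !weighted_normN.
- by move=> k; rewrite ler0n.
- move=> k f Af; have /(A_spaceP w1 w2)[mf _ mFf _] := Af.
  rewrite /truncated_norm /A_norm muleDr ?ge0_adde_def ?inE ?weighted_norm_ge0//.
  by apply: leeD; exact: truncated_weight_norm_le.
- exact: A_norm_ge0.
- move=> f Af; have A34f := sub f Af; exists (fine (N34 f)) => k.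
  rewrite fineK ?ge0_fin_numE ?A_norm_ge0 ?(A_norm_fin w3 w4)//.
  have /(A_spaceP w1 w2)[mf _ mFf _] := Af.
  by apply: leeD; exact: truncated_weight_norm_mono.
- exact: A_complete.
Qed.

(** A ball of radius [d] is mapped into a ball of radius [M' + M'], where the two
terms bound the norm of the function and that of its transform. *)
Lemma inclusion_continuous : A12 `<=` A34 ->
  exists2 c : R, 0 < c & forall f, A12 f -> (N34 f <= c%:E * N12 f)%E.
Proof.
move=> /truncated_norm_bounded[d d0 [M PM]].
pose M' := Num.max M 0.
have M'0 : 0 <= M' by rewrite le_max lexx orbT.
have c0 : 0 < (M' + M' + 1) / d by rewrite divr_gt0// ltr_wpDl// addr_ge0.
have m3 := beurling_measurable w3; have m4 := beurling_measurable w4.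
have g3 := beurling_ge1 w3; have g4 := beurling_ge1 w4.
exists ((M' + M' + 1) / d) => // f Af.
have /(A_spaceP w1 w2)[mf _ mFf _] := Af.
have Nfin : N12 f \is a fin_num.
  by rewrite ge0_fin_numE ?A_norm_ge0 ?(A_norm_fin w1 w2).
have nu0 : 0 <= fine (N12 f) by rewrite fine_ge0// A_norm_ge0.
rewrite -(fineK Nfin); set n := fine _ in nu0 *.
(* The slack [eps] makes the scaling factor [d / (n + eps)] meaningful when the norm
   [n] vanishes; it contributes exactly [e] after multiplication by the constant. *)
apply/lee_addgt0Pr => e e0.
pose eps := e / ((M' + M' + 1) / d).
have eps0 : 0 < eps by rewrite divr_gt0.
pose t := d / (n + eps).
have ne0 : 0 < n + eps by rewrite ltr_wpDl.
have t0 : 0 < t by rewrite divr_gt0.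
pose tf : G -> R[i] := fun x => f x * (t%:C)%C.
have Atf : A12 tf by apply: A_spaceZ => //; exact: ltW.
have Ntf : (N12 tf <= d%:E)%E.
  apply: le_trans (A_normZ_le w1 w2 (ltW t0) Af) _.
  rewrite -(fineK Nfin) -/n -EFinM lee_fin /t mulrAC ler_pdivrMr// ler_wpM2l ?ltW//.
  by rewrite ltrDl.
have tfK : f = (fun x => tf x * (t^-1%:C)%C).
  apply/funext => x; rewrite /tf -mulrA -rmorphM/= divff ?gt_eqF//.
  by rewrite rmorph1 mulr1.
have FtfK : fourier mu f = (fun x => fourier mu tf x * (t^-1%:C)%C).
  by rewrite {1}tfK; apply: (A_fourierZ w1 w2).
have /(A_spaceP w1 w2)[mtf _ mFtf _] := Atf.
have PM' k : (truncated_norm k tf <= M'%:E)%E.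
  by apply: le_trans (PM tf k Atf Ntf) _; rewrite lee_fin le_max lexx.
have tV0 : 0 <= t^-1 by rewrite invr_ge0 ltW.
have b3 : (weighted_norm mu D theta3 p 1 f <= (t^-1 * M')%:E)%E.
  apply: truncated_weight_norm_fatou => // k; rewrite tfK.
  apply: le_trans (weighted_normZ_le _ _ _ _ _ _ _ _) _ => //.
  + exact: measurable_truncated_weight.
  + by move=> x; exact: truncated_weight_ge0.
  rewrite EFinM; apply: lee_pmul => //; first exact: weighted_norm_ge0.
  apply: le_trans (PM' k); rewrite /truncated_norm /A_norm leeDl//.
  exact: weighted_norm_ge0.
have b4 : (weighted_norm nu Dhat theta4 q r (fourier mu f) <= (t^-1 * M')%:E)%E.
  apply: truncated_weight_norm_fatou => // k; rewrite FtfK.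
  apply: le_trans (weighted_normZ_le _ _ _ _ _ _ _ _) _ => //.
  + exact: measurable_truncated_weight.
  + by move=> x; exact: truncated_weight_ge0.
  rewrite EFinM; apply: lee_pmul => //; first exact: weighted_norm_ge0.
  apply: le_trans (PM' k); rewrite /truncated_norm /A_norm leeDr//.
  exact: weighted_norm_ge0.
apply: le_trans (leeD b3 b4) _; rewrite -EFinM -!EFinD lee_fin.
have -> : e = (M' + M' + 1) / d * eps.
  by rewrite /eps mulrCA divff ?mulr1// gt_eqF.
rewrite -mulrDr /t invf_div -mulrDr.
rewrite mulrAC [leRHS]mulrAC ler_pM2r ?invr_gt0// [leRHS]mulrC ler_pM2l//.
by rewrite lerDl.
Qed.

End FourierAmalgam.

Unset Implicit Arguments.

Theorem theorem10 (R : realType) (G : topologicalZmodType)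
  (hausG : hausdorff_space G) (lcG : locally_compact [set: G])
  (mu : {measure set (borel G) -> \bar R})
  (nu : {measure set (borel (dual R G)) -> \bar R})
  (haar_mu : is_haar mu) (haar_nu : is_haar nu)
  (D : lca_decomposition R G) (Dhat : lca_decomposition R (dual R G))
  (mu1 : mu (unit_cell D) = 1%E) (nu1 : nu (unit_cell Dhat) = 1%E)
  (p q r : R) (p1 : 1 <= p) (q1 : 1 <= q) (r1 : 1 <= r)
  (theta1 theta3 : G -> R) (theta2 theta4 : dual R G -> R)
  (w1 : beurling_weight mu theta1) (w3 : beurling_weight mu theta3)
  (w2 : beurling_weight nu theta2) (w4 : beurling_weight nu theta4) :
  A_space mu D nu Dhat p 1 q r theta1 theta2
    `<=` A_space mu D nu Dhat p 1 q r theta3 theta4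
  <->
  continuously_embedded
    (A_space mu D nu Dhat p 1 q r theta1 theta2)
    (A_norm mu D nu Dhat p 1 q r theta1 theta2)
    (A_space mu D nu Dhat p 1 q r theta3 theta4)
    (A_norm mu D nu Dhat p 1 q r theta3 theta4).
Proof.
split=> [sub|[]//]; split=> //.
exact: inclusion_continuous.
Qed.
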